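(* Let $\mathfrak s$ be the two-dimensional Lie algebra with basis $H,E$ and $[H,E]=E$, with a norm such that $\|H\|=1=\|E\|$. For $n\in\mathbb N_0$ let $$F_n=\sum_{k=0}^n(-1)^k\binom nk\,\bigl(E^{n-k}H_{k\uparrow}\bigr)\otimes\bigl(E^kH_{(n-k)\uparrow}\bigr)\in U(\mathfrak s)\otimes U(\mathfrak s),$$ where $H_{k\uparrow}=\prod_{j=0}^{k-1}(H+j)$ and $H_{0\uparrow}=1$, and let $F_\hbar=\sum_{n=0}^\infty\frac{\hbar^n}{n!}F_n$. Let $R=1$ and let $\mu\colon V\otimes W\to X$ be a malleable inductive $\mathfrak s$-triple. Then both of the following hold. (A) For every $r>0$, $q_V\in\mathrm{cs}(V)$, $q_W\in\mathrm{cs}(W)$ and compact $K\subseteq\mathbb C$ there exist $q_V'\in\mathrm{cs}(V)$, $q_W'\in\mathrm{cs}(W)$ and $t,C>0$ such that $$\bigl(p^{(R)}_{r,q_V}\otimes p^{(R)}_{r,q_W}\bigr)\Bigl(\tfrac{\hbar^n}{n!}F_n\triangleright(v\otimes w)\Bigr)\le C\,p^{(R)}_{tr,q_V'}(v)\,p^{(R)}_{tr,q_W'}(w)$$ for all $v\in\mathcal E_R(\varrho_V)$, $w\in\mathcal E_R(\varrho_W)$, $\hbar\in K$, $n\in\mathbb N_0$. (B) For every $\alpha\in J_V$, $\beta\in J_W$, $r_1,r_2>0$, $q_\alpha\in\mathrm{cs}(V_\alpha)$, $q_\beta\in\mathrm{cs}(W_\beta)$ and compact $K\subseteq\mathbb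 C$ there exist $q_\alpha'\in\mathrm{cs}(V_\alpha)$, $q_\beta'\in\mathrm{cs}(W_\beta)$ and $t,C>0$ such that $$\bigl(p^{(R)}_{r,q_\alpha}\otimes p^{(R)}_{r,q_\beta}\bigr)\Bigl(\tfrac{\hbar^n}{n!}F_n\triangleright(v\otimes w)\Bigr)\le C\,p^{(R)}_{tr,q_\alpha'}(v)\,p^{(R)}_{tr,q_\beta'}(w)$$ for all $v\in\mathcal A_{R,r_1}(\varrho_{V,\alpha})$, $w\in\mathcal A_{R,r_2}(\varrho_{W,\beta})$, $r<\frac{2^{-R}}{t}\min\{r_1,r_2\}$, $\hbar\in K$, $n\in\mathbb N_0$.
   Context: Lie algebras are finite-dimensional and real; $\mathbb B$ is the open unit ball of the Lie algebra $\mathfrak g$ (here $\mathfrak g=\mathfrak s$) for its chosen norm. Locally convex spaces are complex. $\mathrm{cs}(V)$ is the set of continuous seminorms, $L(V)$ the continuous linear endomorphisms. A representation is a Lie algebra morphism $\varrho\colon\mathfrak g\to L(V)$, extended to the (complexified) universal enveloping algebra $U(\mathfrak g)$; $\Xi\triangleright v=\varrho(\Xi)v$. $U(\mathfrak g)\otimes U(\mathfrak g)$ acts factorwise on $V\otimes W$. $p\otimes q$ is the projective tensor product of seminorms. A $\mathfrak g$-triple consists of representations $\varrho_V,\varrho_W,\varrho_X$ on locally convex spaces $V,W,X$ and a linear map $\mu\colon V\otimes W\to X$. It is malleable if $\xi\triangleright\mu(v\otimes w)=\mu((\xi\triangleright v)\otimes w+v\otimes(\xi\triangleright w))$ for all $v,w$,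 $\xi\in\mathfrak g$. A fully reduced inductive system is a family $(V_\alpha)_{\alpha\in J}$ of locally convex spaces indexed by a directed set with continuous inclusions $V_\alpha\subseteq V_\beta$ for $\alpha\preccurlyeq\beta$; its inductive limit is $\bigcup_\alpha V_\alpha$ with the final locally convex topology. A $\mathfrak g$-triple is inductive if (i) $V,W,X$ are inductive limits of fully reduced systems $(V_\alpha)_{\alpha\in J_V}$, $(W_\beta)_{\beta\in J_W}$, $(X_\gamma)_{\gamma\in J_X}$ of invariant subspaces; (ii) for all $\alpha,\beta$ there is $\gamma$ such that $\mu\colon V_\alpha\otimes W_\beta\to X_\gamma$ is well-defined and continuous (projective topology). The restrictions $\varrho_{V,\alpha}$ of $\varrho_V$ to $V_\alpha$ and $\varrho_{W,\beta}$ of $\varrho_W$ to $W_\beta$ act by continuous operators. For a representation $\varrho$ on $V$, $R\ge0$, $q\in\mathrm{cs}(V)$, $r\ge0$: $p^{(R)}_{r,q}(v)=\sum_{n=0}^\infty n!^{R-1}r^n\sup_{\xi_1,\dots,\xi_n\in\mathbb B}q(\xi_1\cdots\xi_n\triangleright v)\in[0,\infty]$. For $r_0>0$, $\mathcal A_{R,r_0}(\varrho)=\{v\in V:p^{(R)}_{r,q}(v)<\infty\ \forall q\in\mathrm{cs}(V),0\le r<r_0\}$ with the topology of these seminorms, and $\mathcal E_R(\varrho)=\bigcap_{r_0>0}\mathcal A_{R,r_0}(\varrho)$ with the topology of all $p^{(R)}_{r,q}$, $r\ge0$. *)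

(* Defs.v *)
From HB Require Import structures.
From mathcomp Require Import all_boot all_order all_algebra generic_quotient.
From mathcomp Require Import all_classical all_reals all_analysis.
From mathcomp.real_closed Require Import complex.
Import Order.TTheory GRing.Theory Num.Theory numFieldNormedType.Exports.

Set Implicit Arguments.
Unset Strict Implicit.
Unset Printing Implicit Defensive.

Local Open Scope classical_set_scope.
Local Open Scope quotient_scope.
Local Open Scope complex_scope.
Local Open Scope ring_scope.

Record lieAlgebra (R : realType) := LieAlgebra {
  lie_sort :> vectType R;
  lie_br : lie_sort -> lie_sort -> lie_sort;
  lie_linearl : forall y, linear (lie_br ^~ y);
  lie_linearr : forall x, linear (lie_br x);
  lie_alt : forall x, lie_br x x = 0;
  lie_jacobi : forall x y z,
    lie_br x (lie_br y z) + lie_br y (lie_br z x) + lie_br z (lie_br x y) = 0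
}.

Record lieNorm (R : realType) (g : lieAlgebra R) := LieNorm {
  lie_norm :> g -> R;
  lie_normD : forall x y, lie_norm (x + y) <= lie_norm x + lie_norm y;
  lie_normZ : forall (a : R) x, lie_norm (a *: x) = `|a| * lie_norm x;
  lie_norm0_eq0 : forall x, lie_norm x = 0 -> x = 0
}.

(* [tens V W] is the vector space presented by the generators [v (x) w]
   subject to bilinearity: formal expressions modulo the congruence generated by
   the vector space axioms and the bilinearity relations. *)
Section Tensor.
Variables (K : numFieldType) (V W : lmodType K).

Inductive tterm :=
  | TPure of V & W
  | TZero
  | TAdd of tterm & tterm
  | TScale of K & tterm.

Inductive teq : tterm -> tterm -> Prop :=
  | teq_refl t : teq t t
  | teq_sym t u : teq t u -> teq u t
  | teq_trans t u s : teq t u -> teq u s -> teq t s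
  | teq_add t t' u u' : teq t t' -> teq u u' -> teq (TAdd t u) (TAdd t' u')
  | teq_scale a t t' : teq t t' -> teq (TScale a t) (TScale a t')
  | teq_addA t u s : teq (TAdd t (TAdd u s)) (TAdd (TAdd t u) s)
  | teq_addC t u : teq (TAdd t u) (TAdd u t)
  | teq_add0 t : teq (TAdd TZero t) t
  | teq_scaleA a b t : teq (TScale a (TScale b t)) (TScale (a * b) t)
  | teq_scale0 t : teq (TScale 0 t) TZero
  | teq_scale1 t : teq (TScale 1 t) t
  | teq_scaleDr a t u : teq (TScale a (TAdd t u)) (TAdd (TScale a t) (TScale a u))
  | teq_scaleDl a b t : teq (TScale (a + b) t) (TAdd (TScale a t) (TScale b t))
  | teq_pureDl v v' w : teq (TPure (v + v') w) (TAdd (TPure v w) (TPure v' w))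
  | teq_pureDr v w w' : teq (TPure v (w + w')) (TAdd (TPure v w) (TPure v w'))
  | teq_pureZl a v w : teq (TPure (a *: v) w) (TScale a (TPure v w))
  | teq_pureZr a v w : teq (TPure v (a *: w)) (TScale a (TPure v w)).

HB.instance Definition _ := gen_eqMixin tterm.
HB.instance Definition _ := gen_choiceMixin tterm.

Definition teqb : rel tterm := fun t u => `[< teq t u >].

Lemma teqb_refl : reflexive teqb.
Proof. by move=> t; apply/asboolP; exact: teq_refl. Qed.
Lemma teqb_sym : symmetric teqb.
Proof. by move=> t u; apply/asboolP/asboolP; exact: teq_sym. Qed.
Lemma teqb_trans : transitive teqb.
Proof. by move=> t u s /asboolP ut /asboolP ts; apply/asboolP; exact: teq_trans ts. Qed.

Definition teqv := EquivRel teqb teqb_refl teqb_sym teqb_trans.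

Definition tens : Type := {eq_quot teqv}.
HB.instance Definition _ := Choice.on tens.
HB.instance Definition _ := EqQuotient.on tens.

Definition tclass (t : tterm) : tens := \pi_tens t.

Lemma tclassP t u : tclass t = tclass u <-> teq t u.
Proof.
by split=> [/eqP|tu]; [rewrite piE => /asboolP | apply/eqP; rewrite piE; apply/asboolP].
Qed.

Lemma tclassK t : tclass (repr t) = t. Proof. exact: reprK. Qed.

Lemma repr_tclass t : teq (repr (tclass t)) t.
Proof. by apply/tclassP; rewrite tclassK. Qed.

Definition tpure (v : V) (w : W) : tens := tclass (TPure v w).
Definition tzero : tens := tclass TZero.
Definition tadd (x y : tens) : tens := tclass (TAdd (repr x) (repr y)).
Definition tscale (a : K) (x : tens) : tens := tclass (TScale a (repr x)).
Definition topp (x : tens) : tens := tscale (-1) x.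

Lemma taddE t u : tadd (tclass t) (tclass u) = tclass (TAdd t u).
Proof. by apply/tclassP/teq_add; exact: repr_tclass. Qed.

Lemma tscaleE a t : tscale a (tclass t) = tclass (TScale a t).
Proof. by apply/tclassP/teq_scale; exact: repr_tclass. Qed.

Fact taddA : associative tadd.
Proof.
move=> x y z; rewrite -[x]tclassK -[y]tclassK -[z]tclassK !taddE.
by apply/tclassP; exact: teq_addA.
Qed.

Fact taddC : commutative tadd.
Proof.
by move=> x y; rewrite -[x]tclassK -[y]tclassK !taddE; apply/tclassP; exact: teq_addC.
Qed.

Fact tadd0 : left_id tzero tadd.
Proof. by move=> x; rewrite -[x]tclassK taddE; apply/tclassP; exact: teq_add0. Qed.

Fact taddN : left_inverse tzero topp tadd.
Proof.
move=> x; rewrite /topp -[x]tclassK tscaleE taddE; apply/tclassP.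
apply: (@teq_trans _ (TAdd (TScale (-1) (repr x)) (TScale 1 (repr x)))).
  by apply: teq_add; [exact: teq_refl | exact/teq_sym/teq_scale1].
apply: (teq_trans (teq_sym (teq_scaleDl _ _ _))).
by rewrite addNr; exact: teq_scale0.
Qed.

HB.instance Definition _ := GRing.isZmodule.Build tens taddA taddC tadd0 taddN.

Lemma tclassD t u : tclass t + tclass u = tclass (TAdd t u).
Proof. exact: taddE. Qed.

Fact tscaleA a b x : tscale a (tscale b x) = tscale (a * b) x.
Proof. by rewrite -[x]tclassK !tscaleE; apply/tclassP; exact: teq_scaleA. Qed.

Fact tscale1 : left_id 1 tscale.
Proof. by move=> x; rewrite -[x]tclassK tscaleE; apply/tclassP; exact: teq_scale1. Qed.

Fact tscaleDr : right_distributive tscale +%R.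
Proof.
move=> a x y; rewrite -[x]tclassK -[y]tclassK !(tclassD, tscaleE).
by apply/tclassP; exact: teq_scaleDr.
Qed.

Fact tscaleDl x : {morph tscale^~ x : a b / a + b}.
Proof.
move=> a b; rewrite -[x]tclassK !(tclassD, tscaleE).
by apply/tclassP; exact: teq_scaleDl.
Qed.

HB.instance Definition _ :=
  GRing.Zmodule_isLmodule.Build K tens tscaleA tscale1 tscaleDr tscaleDl.

Lemma tclassZ a t : a *: tclass t = tclass (TScale a t).
Proof. exact: tscaleE. Qed.

Lemma tpureDl v v' w : tpure (v + v') w = tpure v w + tpure v' w.
Proof. by rewrite tclassD; apply/tclassP; exact: teq_pureDl. Qed.

Lemma tpureDr v w w' : tpure v (w + w') = tpure v w + tpure v w'.
Proof. by rewrite tclassD; apply/tclassP; exact: teq_pureDr. Qed.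

Lemma tpureZl a v w : tpure (a *: v) w = a *: tpure v w.
Proof. by rewrite tclassZ; apply/tclassP; exact: teq_pureZl. Qed.

Lemma tpureZr a v w : tpure v (a *: w) = a *: tpure v w.
Proof. by rewrite tclassZ; apply/tclassP; exact: teq_pureZr. Qed.

End Tensor.

Section TensorLift.
Variables (K : numFieldType) (V W Z : lmodType K) (b : V -> W -> Z).

Fixpoint teval (t : tterm V W) : Z :=
  match t with
  | TPure v w => b v w
  | TZero => 0
  | TAdd t u => teval t + teval u
  | TScale a t => a *: teval t
  end.

(* The linear map on [tens V W] induced by [b] (meaningful when [b] is
   bilinear, see [tlift_pure] and [tlift_linear]). *)
Definition tlift (x : tens V W) : Z := teval (repr x).

Hypotheses (b_linearl : forall w, linear (b ^~ w)) (b_linearr : forall v, linear (b v)).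

Lemma teval_teq t u : teq t u -> teval t = teval u.
Proof.
have bDl v v' w : b (v + v') w = b v w + b v' w.
  by have := b_linearl w 1 v v'; rewrite !scale1r.
have bDr v w w' : b v (w + w') = b v w + b v w'.
  by have := b_linearr v 1 w w'; rewrite !scale1r.
have b0l w : b 0 w = 0 by apply: (addrI (b 0 w)); rewrite -bDl !addr0.
have b0r v : b v 0 = 0 by apply: (addrI (b v 0)); rewrite -bDr !addr0.
have bZl a v w : b (a *: v) w = a *: b v w.
  by have := b_linearl w a v 0; rewrite b0l !addr0.
have bZr a v w : b v (a *: w) = a *: b v w.
  by have := b_linearr v a w 0; rewrite b0r !addr0.
elim=> //=.
- by move=> ? ? ? _ -> _ ->.
- by move=> ? ? ? ? _ -> _ ->.
- by move=> ? ? ? _ ->.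
- by move=> *; rewrite addrA.
- by move=> *; rewrite addrC.
- by move=> *; rewrite add0r.
- by move=> *; rewrite scalerA.
- by move=> *; rewrite scale0r.
- by move=> *; rewrite scale1r.
- by move=> *; rewrite scalerDr.
- by move=> *; rewrite scalerDl.
Qed.

Lemma tlift_tclass t : tlift (tclass t) = teval t.
Proof. by apply/teval_teq/repr_tclass. Qed.

Lemma tlift_pure v w : tlift (tpure v w) = b v w.
Proof. by rewrite tlift_tclass. Qed.

Lemma tlift_linear : linear tlift.
Proof.
move=> a x y; rewrite -[x]tclassK -[y]tclassK.
by rewrite tclassZ tclassD !tlift_tclass.
Qed.

End TensorLift.

Lemma tens_sum_pure (K : numFieldType) (V W : lmodType K) (x : tens V W) :
  exists s : seq (V * W), x = \sum_(vw <- s) tpure vw.1 vw.2.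
Proof.
rewrite -[x]tclassK; elim: (repr x) => {x} [v w||t [s1 h1] u [s2 h2]|a t [s h]].
- by exists [:: (v, w)]; rewrite big_seq1.
- by exists [::]; rewrite big_nil.
- by exists (s1 ++ s2); rewrite big_cat /= -h1 -h2 tclassD.
- exists [seq (a *: vw.1, vw.2) | vw <- s]; rewrite big_map /=.
  under eq_bigr do rewrite tpureZl.
  by rewrite -scaler_sumr -h tclassZ.
Qed.

Definition tmap (K : numFieldType) (V W V' W' : lmodType K)
    (f : V -> V') (g : W -> W') : tens V W -> tens V' W' :=
  tlift (fun v w => tpure (f v) (g w)).

(* [uenv g] is the associative unital complex algebra presented by the
   generators [ugen x], [x \in g], subject to real linearity of [ugen] and to
   [ugen [x, y] = ugen x * ugen y - ugen y * ugen x]. *)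
Section Enveloping.
Variables (R : realType) (g : lieAlgebra R).
Local Notation C := R[i].

Inductive uterm :=
  | UScal of C
  | UGen of g
  | UAdd of uterm & uterm
  | UMul of uterm & uterm.

Inductive ueq : uterm -> uterm -> Prop :=
  | ueq_refl t : ueq t t
  | ueq_sym t u : ueq t u -> ueq u t
  | ueq_trans t u s : ueq t u -> ueq u s -> ueq t s
  | ueq_add t t' u u' : ueq t t' -> ueq u u' -> ueq (UAdd t u) (UAdd t' u')
  | ueq_mul t t' u u' : ueq t t' -> ueq u u' -> ueq (UMul t u) (UMul t' u')
  | ueq_addA t u s : ueq (UAdd t (UAdd u s)) (UAdd (UAdd t u) s)
  | ueq_addC t u : ueq (UAdd t u) (UAdd u t)
  | ueq_add0 t : ueq (UAdd (UScal 0) t) t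
  | ueq_mul0 t : ueq (UMul (UScal 0) t) (UScal 0)
  | ueq_mulA t u s : ueq (UMul t (UMul u s)) (UMul (UMul t u) s)
  | ueq_mul1l t : ueq (UMul (UScal 1) t) t
  | ueq_mulDl t u s : ueq (UMul (UAdd t u) s) (UAdd (UMul t s) (UMul u s))
  | ueq_mulDr t u s : ueq (UMul t (UAdd u s)) (UAdd (UMul t u) (UMul t s))
  | ueq_scalD a b : ueq (UScal (a + b)) (UAdd (UScal a) (UScal b))
  | ueq_scalM a b : ueq (UScal (a * b)) (UMul (UScal a) (UScal b))
  | ueq_scalC a t : ueq (UMul (UScal a) t) (UMul t (UScal a))
  | ueq_genD x y : ueq (UGen (x + y)) (UAdd (UGen x) (UGen y))
  | ueq_genZ (a : R) x : ueq (UGen (a *: x)) (UMul (UScal a%:C) (UGen x))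
  | ueq_genB x y : ueq (UAdd (UGen (lie_br x y)) (UMul (UGen y) (UGen x)))
                       (UMul (UGen x) (UGen y)).

HB.instance Definition _ := gen_eqMixin uterm.
HB.instance Definition _ := gen_choiceMixin uterm.

Definition ueqb : rel uterm := fun t u => `[< ueq t u >].

Lemma ueqb_refl : reflexive ueqb.
Proof. by move=> t; apply/asboolP; exact: ueq_refl. Qed.
Lemma ueqb_sym : symmetric ueqb.
Proof. by move=> t u; apply/asboolP/asboolP; exact: ueq_sym. Qed.
Lemma ueqb_trans : transitive ueqb.
Proof. by move=> t u s /asboolP ut /asboolP ts; apply/asboolP; exact: ueq_trans ts. Qed.

Definition ueqv := EquivRel ueqb ueqb_refl ueqb_sym ueqb_trans.

Definition uenv : Type := {eq_quot ueqv}.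
HB.instance Definition _ := Choice.on uenv.
HB.instance Definition _ := EqQuotient.on uenv.

Definition uclass (t : uterm) : uenv := \pi_uenv t.

Lemma uclassP t u : uclass t = uclass u <-> ueq t u.
Proof.
by split=> [/eqP|tu]; [rewrite piE => /asboolP | apply/eqP; rewrite piE; apply/asboolP].
Qed.

Lemma uclassK t : uclass (repr t) = t. Proof. exact: reprK. Qed.

Lemma repr_uclass t : ueq (repr (uclass t)) t.
Proof. by apply/uclassP; rewrite uclassK. Qed.

Definition uscal (a : C) : uenv := uclass (UScal a).
Definition ugen (x : g) : uenv := uclass (UGen x).
Definition uadd (x y : uenv) : uenv := uclass (UAdd (repr x) (repr y)).
Definition umul (x y : uenv) : uenv := uclass (UMul (repr x) (repr y)).
Definition uopp (x : uenv) : uenv := umul (uscal (-1)) x.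
Definition uscale (a : C) (x : uenv) : uenv := umul (uscal a) x.

Lemma uaddE t u : uadd (uclass t) (uclass u) = uclass (UAdd t u).
Proof. by apply/uclassP/ueq_add; exact: repr_uclass. Qed.

Lemma umulE t u : umul (uclass t) (uclass u) = uclass (UMul t u).
Proof. by apply/uclassP/ueq_mul; exact: repr_uclass. Qed.

Fact uaddA : associative uadd.
Proof.
move=> x y z; rewrite -[x]uclassK -[y]uclassK -[z]uclassK !uaddE.
by apply/uclassP; exact: ueq_addA.
Qed.

Fact uaddC : commutative uadd.
Proof.
by move=> x y; rewrite -[x]uclassK -[y]uclassK !uaddE; apply/uclassP; exact: ueq_addC.
Qed.

Fact uadd0 : left_id (uscal 0) uadd.
Proof. by move=> x; rewrite -[x]uclassK uaddE; apply/uclassP; exact: ueq_add0. Qed.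

Fact umulA : associative umul.
Proof.
move=> x y z; rewrite -[x]uclassK -[y]uclassK -[z]uclassK !umulE.
by apply/uclassP; exact: ueq_mulA.
Qed.

Fact umul1l : left_id (uscal 1) umul.
Proof. by move=> x; rewrite -[x]uclassK umulE; apply/uclassP; exact: ueq_mul1l. Qed.

Fact uscalC a x : umul (uscal a) x = umul x (uscal a).
Proof. by rewrite -[x]uclassK !umulE; apply/uclassP; exact: ueq_scalC. Qed.

Fact umul1r : right_id (uscal 1) umul.
Proof. by move=> x; rewrite -uscalC umul1l. Qed.

Fact umulDl : left_distributive umul uadd.
Proof.
move=> x y z; rewrite -[x]uclassK -[y]uclassK -[z]uclassK !(uaddE, umulE).
by apply/uclassP; exact: ueq_mulDl.
Qed.

Fact umulDr : right_distributive umul uadd.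
Proof.
move=> x y z; rewrite -[x]uclassK -[y]uclassK -[z]uclassK !(uaddE, umulE).
by apply/uclassP; exact: ueq_mulDr.
Qed.

Fact uscalD a b : uscal (a + b) = uadd (uscal a) (uscal b).
Proof. by rewrite uaddE; apply/uclassP; exact: ueq_scalD. Qed.

Fact uscalM a b : uscal (a * b) = umul (uscal a) (uscal b).
Proof. by rewrite umulE; apply/uclassP; exact: ueq_scalM. Qed.

Fact umul0l x : umul (uscal 0) x = uscal 0.
Proof. by rewrite -[x]uclassK umulE; apply/uclassP; exact: ueq_mul0. Qed.

Fact uaddN : left_inverse (uscal 0) uopp uadd.
Proof.
by move=> x; rewrite -{2}[x]umul1l -umulDl -uscalD addNr umul0l.
Qed.

HB.instance Definition _ := GRing.isZmodule.Build uenv uaddA uaddC uadd0 uaddN.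

Lemma uclassD t u : uclass t + uclass u = uclass (UAdd t u).
Proof. exact: uaddE. Qed.

Fixpoint ucounit (t : uterm) : C :=
  match t with
  | UScal a => a
  | UGen _ => 0
  | UAdd t u => ucounit t + ucounit u
  | UMul t u => ucounit t * ucounit u
  end.

Lemma ucounit_ueq t u : ueq t u -> ucounit t = ucounit u.
Proof.
elim=> //=.
- by move=> ? ? ? _ -> _ ->.
- by move=> ? ? ? ? _ -> _ ->.
- by move=> ? ? ? ? _ -> _ ->.
- by move=> *; rewrite addrA.
- by move=> *; rewrite addrC.
- by move=> *; rewrite add0r.
- by move=> *; rewrite mul0r.
- by move=> *; rewrite mulrA.
- by move=> *; rewrite mul1r.
- by move=> *; rewrite mulrDl.
- by move=> *; rewrite mulrDr.
- by move=> *; rewrite mulrC.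
- by move=> *; rewrite addr0.
- by move=> *; rewrite mulr0.
- by move=> *; rewrite mulr0 addr0.
Qed.

Fact uscal1_neq0 : uscal 1 != 0.
Proof. by apply/eqP => /uclassP/ucounit_ueq/= /eqP; rewrite oner_eq0. Qed.

HB.instance Definition _ := GRing.Zmodule_isNzRing.Build uenv
  umulA umul1l umul1r umulDl umulDr uscal1_neq0.

Lemma uclassM t u : uclass t * uclass u = uclass (UMul t u).
Proof. exact: umulE. Qed.

Fact uscaleA a b x : uscale a (uscale b x) = uscale (a * b) x.
Proof. by rewrite /uscale umulA -uscalM. Qed.

Fact uscale1 : left_id 1 uscale. Proof. exact: umul1l. Qed.

Fact uscaleDr : right_distributive uscale +%R.
Proof. by move=> a x y; exact: umulDr. Qed.

Fact uscaleDl x : {morph uscale^~ x : a b / a + b}.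
Proof. by move=> a b; rewrite /uscale uscalD; exact: umulDl. Qed.

HB.instance Definition _ :=
  GRing.Zmodule_isLmodule.Build C uenv uscaleA uscale1 uscaleDr uscaleDl.

Fact uscaleAl (a : C) (x y : uenv) : a *: (x * y) = (a *: x) * y.
Proof. exact: umulA. Qed.

HB.instance Definition _ := GRing.Lmodule_isLalgebra.Build C uenv uscaleAl.

Fact uscaleAr (a : C) (x y : uenv) : a *: (x * y) = x * (a *: y).
Proof.
change (umul (uscal a) (umul x y) = umul x (umul (uscal a) y)).
by rewrite umulA uscalC -umulA.
Qed.

HB.instance Definition _ := GRing.Lalgebra_isAlgebra.Build C uenv uscaleAr.

Lemma uclassZ a t : a *: uclass t = uclass (UMul (UScal a) t).
Proof. exact: umulE. Qed.

Lemma ugenD x y : ugen (x + y) = ugen x + ugen y.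
Proof. by rewrite uclassD; apply/uclassP; exact: ueq_genD. Qed.

Lemma ugenZ (a : R) x : ugen (a *: x) = a%:C *: ugen x.
Proof. by rewrite uclassZ; apply/uclassP; exact: ueq_genZ. Qed.

Lemma ugen_br x y : ugen (lie_br x y) = ugen x * ugen y - ugen y * ugen x.
Proof.
apply/eqP; rewrite eq_sym subr_eq; apply/eqP/esym.
by rewrite !uclassM uclassD; apply/uclassP; exact: ueq_genB.
Qed.

End Enveloping.

Record cseminorm (R : realType) (V : tvsType R[i]) := CSeminorm {
  csn :> V -> R;
  csnD : forall v w, csn (v + w) <= csn v + csn w;
  csnZ : forall (a : R[i]) v, csn (a *: v) = Normc.normc a * csn v;
  csn_continuous : continuous csn
}.

Record representation (R : realType) (g : lieAlgebra R) (V : tvsType R[i]) :=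
  Representation {
    ract :> g -> {linear V -> V};
    ract_continuous : forall x, continuous (ract x);
    ractD : forall x y v, ract (x + y) v = ract x v + ract y v;
    ractZ : forall (a : R) x v, ract (a *: x) v = a%:C *: ract x v;
    ract_br : forall x y v,
      ract (lie_br x y) v = ract x (ract y v) - ract y (ract x v)
  }.

Section EnvelopingAction.
Variables (R : realType) (g : lieAlgebra R) (V : tvsType R[i]).
Variable rho : representation g V.

Fixpoint ueval (t : uterm g) (v : V) : V :=
  match t with
  | UScal a => a *: v
  | UGen x => rho x v
  | UAdd t u => ueval t v + ueval u v
  | UMul t u => ueval t (ueval u v)
  end.

Definition uact (X : uenv g) (v : V) : V := ueval (repr X) v.

Lemma ueval_linear t : linear (ueval t).
Proof.
elim: t => [a|x|t ht u hu|t ht u hu] b v w /=.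
- by rewrite scalerDr !scalerA mulrC.
- exact: linearP.
- by rewrite ht hu scalerDr addrACA.
- by rewrite hu ht.
Qed.

Lemma ueval_ueq t u v : ueq t u -> ueval t v = ueval u v.
Proof.
move=> tu; elim: tu v => //=.
- by move=> ? ? ? _ h1 _ h2 v; rewrite h1.
- by move=> ? ? ? ? _ h1 _ h2 v; rewrite h1 h2.
- by move=> ? ? ? ? _ h1 _ h2 v; rewrite h1 h2.
- by move=> *; rewrite addrA.
- by move=> *; rewrite addrC.
- by move=> *; rewrite scale0r add0r.
- by move=> *; rewrite !scale0r.
- by move=> *; rewrite scale1r.
- by move=> t1 t2 t3 v; have := ueval_linear t1 1 (ueval t2 v) (ueval t3 v); rewrite !scale1r.
- by move=> *; rewrite scalerDl.
- by move=> *; rewrite scalerA.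
- move=> a t1 v; have t0 : ueval t1 0 = 0.
    by have := ueval_linear t1 (-1) 0 0; rewrite !scaleN1r oppr0 add0r addNr.
  by have := ueval_linear t1 a v 0; rewrite t0 !addr0.
- by move=> *; rewrite ractD.
- by move=> *; rewrite ractZ.
- by move=> *; rewrite ract_br subrK.
Qed.

Lemma uact_uclass t v : uact (uclass t) v = ueval t v.
Proof. exact/ueval_ueq/repr_uclass. Qed.

Lemma uact_ugen x v : uact (ugen x) v = rho x v.
Proof. exact: uact_uclass. Qed.

Lemma uact1 v : uact 1 v = v.
Proof. by rewrite uact_uclass /= scale1r. Qed.

Lemma uactM X Y v : uact (X * Y) v = uact X (uact Y v).
Proof. by rewrite -[X]uclassK -[Y]uclassK uclassM !uact_uclass. Qed.

Lemma uact_linear X : linear (uact X).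
Proof. exact: ueval_linear. Qed.

Lemma uact_linearl v : linear (uact ^~ v).
Proof.
move=> a X Y; rewrite -[X]uclassK -[Y]uclassK uclassZ uclassD.
by rewrite !uact_uclass.
Qed.

End EnvelopingAction.

Definition tact (R : realType) (g : lieAlgebra R) (V W : tvsType R[i])
    (rhoV : representation g V) (rhoW : representation g W)
    (F : tens (uenv g) (uenv g)) (z : tens V W) : tens V W :=
  tlift (fun X Y => tmap (uact rhoV X) (uact rhoW Y) z) F.

Lemma tmap_pure (K : numFieldType) (V W V' W' : lmodType K)
    (f : V -> V') (g : W -> W') v w : linear f -> linear g ->
  tmap f g (tpure v w) = tpure (f v) (g w).
Proof.
by move=> fl gl; apply: tlift_pure => [y a x x'|x a y y'];
  rewrite ?fl ?gl ?tpureDl ?tpureDr ?tpureZl ?tpureZr.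
Qed.

Lemma tact_pure (R : realType) (g : lieAlgebra R) (V W : tvsType R[i])
    (rhoV : representation g V) (rhoW : representation g W) X Y v w :
  tact rhoV rhoW (tpure X Y) (tpure v w) = tpure (uact rhoV X v) (uact rhoW Y w).
Proof.
have bE X' Y' : tmap (uact rhoV X') (uact rhoW Y') (tpure v w) =
    tpure (uact rhoV X' v) (uact rhoW Y' w).
  by apply: tmap_pure; exact: uact_linear.
rewrite /tact tlift_pure// => [Y' a X1 X2|X' a Y1 Y2].
- by rewrite !bE uact_linearl tpureDl tpureZl.
- by rewrite !bE uact_linearl tpureDr tpureZr.
Qed.

(* The projective tensor product of seminorms [p] on the subspace [A] of [V] and
   [q] on the subspace [B] of [W], evaluated on [A (x) B] seen inside
   [V (x) W]; it is [+oo] outside of [A (x) B]. *)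
Definition projective (R : realType) (V W : lmodType R[i]) (A : set V) (B : set W)
    (p : V -> \bar R) (q : W -> \bar R) (z : tens V W) : \bar R :=
  ereal_inf [set (\sum_(vw <- s) p vw.1 * q vw.2)%E
            | s in [set s : seq (V * W) |
                     {in s, forall vw, A vw.1 /\ B vw.2} /\
                     z = \sum_(vw <- s) tpure vw.1 vw.2]].

(* Neighbourhoods of [z] in the projective topology of [V (x) W]; the seminorms
   [p (x) q] are directed, so that single balls form a basis. *)
Definition projective_nbhs (R : realType) (V W : tvsType R[i]) (z : tens V W) :
    set_system (tens V W) :=
  [set U | exists (p : cseminorm V) (q : cseminorm W) (e : R), 0 < e /\
     [set z' | (projective setT setT (EFin \o p) (EFin \o q) (z' - z)%R < e%:E)%E]
       `<=` U].

Record directedSet := DirectedSet {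
  ds_sort :> Type;
  ds_le : ds_sort -> ds_sort -> Prop;
  ds_refl : forall a, ds_le a a;
  ds_trans : forall a b c, ds_le a b -> ds_le b c -> ds_le a c;
  ds_ub : forall a b, exists c, ds_le a c /\ ds_le b c;
  ds_inhabited : inhabited ds_sort
}.

(* A fully reduced inductive system of subspaces of [V]. A subspace with its own
   topology is a space [fr_space a] with an injective linear map to [V]. *)
Record frSystem (R : realType) (V : tvsType R[i]) := FrSystem {
  fr_index :> directedSet;
  fr_space : fr_index -> tvsType R[i];
  fr_incl : forall a, {linear fr_space a -> V};
  fr_incl_inj : forall a, injective (fr_incl a);
  fr_incl_le : forall a b, ds_le a b ->
    exists j : fr_space a -> fr_space b,
      continuous j /\ forall u, fr_incl b (j u) = fr_incl a u
}.

Arguments fr_space {R V} S a : rename.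
Arguments fr_incl {R V} S a : rename.

(* [V] is the union of the system and carries the finest locally convex topology
   that makes the inclusions continuous. *)
Definition is_inductive_limit (R : realType) (V : tvsType R[i]) (S : frSystem V) :=
  [/\ forall v, exists a u, fr_incl S a u = v,
      forall a, continuous (fr_incl S a) &
      forall (Y : tvsType R[i]) (f : {linear V -> Y}),
        (forall a, continuous (f \o fr_incl S a)) -> continuous f].

Section Triples.
Variables (R : realType) (g : lieAlgebra R).

Definition invariant_system (V : tvsType R[i]) (rho : representation g V)
    (S : frSystem V) :=
  forall a x u, exists u', fr_incl S a u' = rho x (fr_incl S a u).

(* [rhoS a] is the restriction of [rho] to [fr_space S a]; being a
   [representation], it acts by continuous operators. *)
Definition is_restriction (V : tvsType R[i]) (rho : representation g V)
    (S : frSystem V) (rhoS : forall a, representation g (fr_space S a)) :=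
  forall a x u, fr_incl S a (rhoS a x u) = rho x (fr_incl S a u).

Variables V W X : tvsType R[i].
Variables (rhoV : representation g V) (rhoW : representation g W).
Variables (rhoX : representation g X) (mu : {linear tens V W -> X}).

Definition malleable :=
  forall x v w, rhoX x (mu (tpure v w)) =
                mu (tpure (rhoV x v) w + tpure v (rhoW x w)).

Record inductive_triple (SV : frSystem V) (SW : frSystem W) (SX : frSystem X) :
    Prop := InductiveTriple {
  it_limV : is_inductive_limit SV;
  it_limW : is_inductive_limit SW;
  it_limX : is_inductive_limit SX;
  it_invV : invariant_system rhoV SV;
  it_invW : invariant_system rhoW SW;
  it_invX : invariant_system rhoX SX;
  it_mu : forall a b, exists c,
    exists2 m : {linear tens (fr_space SV a) (fr_space SW b) -> fr_space SX c},
      forall z, fr_incl SX c (m z) = mu (tmap (fr_incl SV a) (fr_incl SW b) z) &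
      forall z, m @ projective_nbhs z --> m z
}.

End Triples.

Section Analytic.
Variables (R : realType) (g : lieAlgebra R) (N : lieNorm g).
Variables (V : tvsType R[i]) (rho : representation g V).

(* The seminorm p^(o)_(r,q); [o] is the order of the analytic vectors. *)
Definition pnorm (o r : R) (q : V -> R) (v : V) : \bar R :=
  (\sum_(0 <= n <oo) ((n`!%:R `^ (o - 1) * r ^+ n)%:E *
     ereal_sup [set (q (uact rho (\prod_(i < n) ugen (xi i)) v))%:E
               | xi in [set xi : 'I_n -> g | forall i, (N (xi i) < 1)%R]]))%E.

Definition analytic (o r0 : R) : set V :=
  [set v | forall (q : cseminorm V) r, 0 <= r -> r < r0 ->
           (pnorm o r q v < +oo)%E].

Definition entire (o : R) : set V :=
  \bigcap_(r0 in [set r0 : R | 0 < r0]) analytic o r0.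

End Analytic.

Section Twist.
Variables (R : realType) (s : lieAlgebra R) (H E : s).

Definition rising (k : nat) : uenv s := \prod_(j < k) (ugen H + j%:R).

Definition twist (n : nat) : tens (uenv s) (uenv s) :=
  \sum_(k < n.+1) ((-1) ^+ k * 'C(n, k)%:R) *:
    tpure (ugen E ^+ (n - k) * rising k) (ugen E ^+ k * rising (n - k)).

(* The [n]-th summand of F_hbar. *)
Definition twist_term (hbar : R[i]) (n : nat) : tens (uenv s) (uenv s) :=
  (hbar ^+ n / n`!%:R) *: twist n.

End Twist.

(* Main.v *)
Require Import Defs.
From mathcomp Require Import all_boot all_order all_algebra.
From mathcomp Require Import all_classical all_reals all_analysis.
From mathcomp.real_closed Require Import complex.
From mathcomp Require Import ring lra.
Import Order.TTheory GRing.Theory Num.Theory numFieldNormedType.Exports.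

(** At order one, analyticity bounds the exponential growth of the words in the
    Lie algebra: if [v] is analytic of radius [r0], then for every continuous
    seminorm [q] and every [d < r0] the value of [q] at (word of length l) . v
    is at most a constant times [d^-l].

    This is incompatible with high powers of [E].  Since [a E^a = [H, E^a]],
    iterating the commutator [m] times expresses [a^m E^a] as a signed sum of
    [2^m] words of length [m + a].  Hence [a^m q(E^a v)] is at most a constant
    times [(2/d)^m], and letting [m] grow gives [q(E^a v) = 0] as soon as
    [a r0 > 2] ([analytic_exp_eq0]).  In the [k]-th term of [F_n] the exponents
    of [E] in the two tensor factors add up to [n].  So for entire vectors every
    term with [n >= 1] is annihilated by the seminorms, which is part (A), and
    for analytic vectors of radii [r1] and [r2] the same holds once [n] exceeds
    a bound depending on [r1] and [r2] alone.

    For (B) only finitely many elements of the enveloping algebra remain, and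
    what is left is to let a fixed element act with a loss in the parameter [t]
    that is uniform in small [r], [r = 0] included ([uenv_dominated]).  For a
    generator [x] this is done by moving [x] to the left through a word: each
    transposition with a letter of the unit ball costs a commutator, whose
    coordinates in the basis [H], [E] are bounded by a constant [c] times those
    of [x].  A word of length [m] thus contributes [c^j] times words of length
    [m - j] in ['C(m, j)] ways, and summing against [r^m] costs only a
    replacement of [r] by [2 r] when [2 c r <= 1] ([comm_bound_series]). *)

Set Implicit Arguments.
Unset Strict Implicit.
Unset Printing Implicit Defensive.

Local Open Scope classical_set_scope.
Local Open Scope complex_scope.
Local Open Scope ring_scope.

(** * The modulus of complex numbers *)

Section Modulus.
Context {R : realType}.
Implicit Types (a : R[i]).

Lemma normc_ge0 a : 0 <= Normc.normc a.
Proof. by case: a => x y; exact: sqrtr_ge0. Qed.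

Lemma normc_real (x : R) : Normc.normc x%:C = `|x|.
Proof. by rewrite /Normc.normc /= expr0n addr0 sqrtr_sqr. Qed.

Lemma normcX a n : Normc.normc (a ^+ n) = Normc.normc a ^+ n.
Proof.
elim: n => [|n IH]; first by rewrite !expr0 Normc.normc1.
by rewrite !exprS Normc.normcM IH.
Qed.

Lemma normc_nat n : Normc.normc (n%:R : R[i]) = n%:R.
Proof. by rewrite -(rmorph_nat (real_complex R)) normc_real normr_nat. Qed.

End Modulus.

Lemma norm_normc {R : realType} (z : R[i]) : `|z| = (Normc.normc z)%:C.
Proof. by case: z. Qed.

Lemma normc_continuous {R : realType} :
  continuous (fun x : (R[i] : numFieldType) => Normc.normc x : R).
Proof.
move=> x; have FF : Filter (nbhs x) by exact: nbhs_filter.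
apply/(@cvgrPdist_lt _ _ _ _ FF) => e e0.
near=> y; rewrite -ltcR -normc_real -norm_normc rmorphB /= -!norm_normc.
apply: (le_lt_trans (ler_dist_dist _ _)).
near: y; exists e%:C; first by rewrite /= ltcR.
by move=> y.
Unshelve. all: end_near. Qed.

Lemma compact_normc_bounded {R : realType} (K : set (R[i] : numFieldType)) :
  compact K -> exists2 B : R, 1 <= B & forall z, K z -> Normc.normc z <= B.
Proof.
move=> cK.
have : compact [set Normc.normc z | z in K].
  apply: continuous_compact cK; apply: continuous_subspaceT.
  exact: normc_continuous.
move=> /compact_bounded [M [_ hM]].
exists (Num.max 1 (M + 1)); first by rewrite le_max lexx.
move=> z Kz; have := hM (M + 1); rewrite ltrDl ltr01 => /(_ isT (Normc.normc z)).
rewrite /= ger0_norm ?normc_ge0// le_max => ->; rewrite ?orbT//.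
by exists z.
Qed.

(** * Seminorms, the action of the enveloping algebra, words *)

Section Seminorms.
Context {R : realType} {V : tvsType R[i]}.
Implicit Types (q : cseminorm V) (v w : V).

Lemma csn0 q : q 0 = 0.
Proof. by rewrite -(scale0r (0 : V)) csnZ Normc.normc0 mul0r. Qed.

Lemma csnN q v : q (- v) = q v.
Proof. by rewrite -scaleN1r csnZ normcN Normc.normc1 mul1r. Qed.

Lemma csn_ge0 q v : 0 <= q v.
Proof.
have := csnD q v (- v); rewrite subrr csn0 csnN -mulr2n.
by rewrite pmulrn_lge0.
Qed.

Lemma csnB q v w : q (v - w) <= q v + q w.
Proof. by rewrite (le_trans (csnD q _ _))// csnN. Qed.

Program Definition add_csn q1 q2 : cseminorm V :=
  @CSeminorm R V (fun v => q1 v + q2 v) _ _ _.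
Next Obligation. by move=> q1 q2 v w /=; rewrite addrACA lerD// csnD. Qed.
Next Obligation. by move=> q1 q2 a v /=; rewrite !csnZ mulrDr. Qed.
Next Obligation.
by move=> q1 q2 v; apply: cvgD; exact: csn_continuous.
Qed.

Program Definition comp_csn {g : lieAlgebra R} (rho : representation g V) q x :
  cseminorm V := @CSeminorm R V (fun v => q (rho x v)) _ _ _.
Next Obligation. by move=> g rho q x v w /=; rewrite raddfD csnD. Qed.
Next Obligation. by move=> g rho q x a v /=; rewrite linearZ csnZ. Qed.
Next Obligation.
move=> g rho q x v; apply: (@continuous_comp _ _ _ (rho x) q).
  exact: ract_continuous.
exact: csn_continuous.
Qed.

End Seminorms.

Section Action.
Context {R : realType} {g : lieAlgebra R} {V : tvsType R[i]}.
Variable rho : representation g V.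
Implicit Types (X Y : uenv g) (v w : V).

Lemma uactDr X v w : uact rho X (v + w) = uact rho X v + uact rho X w.
Proof. by have := uact_linear rho X 1 v w; rewrite !scale1r. Qed.

Lemma uact0r X : uact rho X 0 = 0.
Proof. by apply: (addrI (uact rho X 0)); rewrite -uactDr !addr0. Qed.

Lemma uactZr X a v : uact rho X (a *: v) = a *: uact rho X v.
Proof. by have := uact_linear rho X a v 0; rewrite uact0r !addr0. Qed.

Lemma uactDl X Y v : uact rho (X + Y) v = uact rho X v + uact rho Y v.
Proof. by have := uact_linearl rho v 1 X Y; rewrite !scale1r. Qed.

Lemma uact0l v : uact rho 0 v = 0.
Proof. by apply: (addrI (uact rho 0 v)); rewrite -uactDl !addr0. Qed.

Lemma uactZl a X v : uact rho (a *: X) v = a *: uact rho X v.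
Proof. by have := uact_linearl rho v a X 0; rewrite uact0l !addr0. Qed.

Lemma uactBl X Y v : uact rho (X - Y) v = uact rho X v - uact rho Y v.
Proof. by rewrite -scaleN1r uactDl uactZl scaleN1r. Qed.

End Action.

Section Words.
Context {R : realType} {g : lieAlgebra R}.
Implicit Types (l : seq g).

Definition uword (l : seq g) : uenv g := \prod_(x <- l) ugen x.

Lemma uword_cons x l : uword (x :: l) = ugen x * uword l.
Proof. exact: big_cons. Qed.

Lemma uword_cat l1 l2 : uword (l1 ++ l2) = uword l1 * uword l2.
Proof. exact: big_cat. Qed.

Lemma uword_nseq n x : uword (nseq n x) = ugen x ^+ n.
Proof.
elim: n => [|n IH] /=; first by rewrite /uword big_nil.
by rewrite uword_cons IH exprS.
Qed.

Lemma uword_scale (a : R) l :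
  uword [seq a *: x | x <- l] = (a%:C ^+ size l) *: uword l.
Proof.
elim: l => [|x l IH] /=; first by rewrite /uword !big_nil expr0 scale1r.
by rewrite !uword_cons IH ugenZ -scalerAl -scalerAr scalerA -exprS.
Qed.

End Words.

(** * The seminorms of analytic vectors *)

Section Pnorm.
Context {R : realType} {g : lieAlgebra R} (N : lieNorm g).
Context {V : tvsType R[i]} (rho : representation g V).
Implicit Types (q : cseminorm V) (v w : V) (l : seq g).

Local Notation in_ball := (fun x : g => N x < 1).

Definition wsup (q : V -> R) (n : nat) (v : V) : \bar R :=
  ereal_sup [set (q (uact rho (\prod_(i < n) ugen (xi i)) v))%:E
               | xi in [set xi : 'I_n -> g | forall i, (N (xi i) < 1)%R]].

Lemma lie_norm0 : N 0 = 0.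
Proof. by rewrite -(scale0r (0 : g)) lie_normZ normr0 mul0r. Qed.

Lemma lie_norm_ge0 x : 0 <= N x.
Proof.
have := lie_normD N x (- x); rewrite subrr lie_norm0 -scaleN1r lie_normZ.
by rewrite normrN1 mul1r -mulr2n pmulrn_lge0.
Qed.

Lemma wsup_ge q l v : all in_ball l ->
  ((q (uact rho (uword l) v))%:E <= wsup q (size l) v)%E.
Proof.
move=> /all_nthP lb; apply: ereal_sup_ubound.
exists (fun i => nth 0 l i) => [i /=|]; first exact: lb.
by rewrite /uword (big_nth 0) big_mkord.
Qed.

Lemma wsup_le q n v M :
  (forall l, size l = n -> all in_ball l ->
    ((q (uact rho (uword l) v))%:E <= M)%E) ->
  (wsup q n v <= M)%E.
Proof.
move=> h; apply: ge_ereal_sup => _ [xi /= xib <-].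
have [t tE] : exists t : n.-tuple g, forall i, tnth t i = xi i.
  by exists [tuple xi i | i < n] => i; rewrite tnth_mktuple.
have := h t; rewrite size_tuple /uword big_tuple.
rewrite (eq_bigr _ (fun i _ => congr1 (@ugen R g) (tE i))).
by apply=> //; apply/all_tnthP => i; rewrite tE.
Qed.

Lemma wsup_ge0 q n v : (0 <= wsup q n v)%E.
Proof.
have := @wsup_ge q (nseq n 0) v; rewrite size_nseq => h.
apply: le_trans (h _); first by rewrite lee_fin csn_ge0.
by rewrite all_nseq lie_norm0 ltr01 orbT.
Qed.

Lemma pnormE r q v :
  pnorm N rho 1 r q v = (\sum_(0 <= n <oo) (r ^+ n)%:E * wsup q n v)%E.
Proof.
rewrite /pnorm; congr (limn _); apply/funext => m.
by apply: eq_bigr => n _; rewrite subrr powRr0 mul1r.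
Qed.

Lemma pnorm_term_ge0 r q v n : 0 <= r -> (0 <= (r ^+ n)%:E * wsup q n v)%E.
Proof. by move=> r0; rewrite mule_ge0 ?wsup_ge0// lee_fin exprn_ge0. Qed.

Lemma pnorm_ge0 r q v : 0 <= r -> (0 <= pnorm N rho 1 r q v)%E.
Proof.
move=> r0; rewrite pnormE; apply: nneseries_ge0 => n _ _.
exact: pnorm_term_ge0.
Qed.

Lemma pnorm_term_le r q v n : 0 <= r ->
  ((r ^+ n)%:E * wsup q n v <= pnorm N rho 1 r q v)%E.
Proof.
move=> r0; rewrite pnormE.
apply: le_trans (@nneseries_lim_ge R _ xpredT 0 n.+1 _).
  rewrite big_mkord big_ord_recr /= leeDr// sume_ge0// => i _.
  exact: pnorm_term_ge0.
by move=> i _ _; exact: pnorm_term_ge0.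
Qed.

Lemma le_pnorm r r' q q' v : 0 <= r -> r <= r' -> (forall u, q u <= q' u) ->
  (pnorm N rho 1 r q v <= pnorm N rho 1 r' q' v)%E.
Proof.
move=> r0 rr' qq'; rewrite !pnormE; apply: lee_nneseries => n _.
  by move=> _; exact: pnorm_term_ge0.
apply: lee_pmul; rewrite ?wsup_ge0 ?lee_fin ?exprn_ge0//.
  by rewrite lerXn2r ?nnegrE ?(le_trans r0).
apply: wsup_le => l <- lb; apply: le_trans (wsup_ge q' v lb).
by rewrite lee_fin.
Qed.

Lemma wsupD q n v w : (wsup q n (v + w)%R <= wsup q n v + wsup q n w)%E.
Proof.
apply: wsup_le => l <- lb.
apply: le_trans (leeD (wsup_ge q v lb) (wsup_ge q w lb)).
by rewrite -EFinD lee_fin uactDr csnD.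
Qed.

Lemma pnormD r q v w : 0 <= r ->
  (pnorm N rho 1 r q (v + w)%R <= pnorm N rho 1 r q v + pnorm N rho 1 r q w)%E.
Proof.
move=> r0; rewrite !pnormE -nneseriesD; try by move=> *; exact: pnorm_term_ge0.
apply: lee_nneseries => n _; first by move=> _; exact: pnorm_term_ge0.
by rewrite -ge0_muleDr ?wsup_ge0// lee_wpmul2l ?wsupD// lee_fin exprn_ge0.
Qed.

Lemma pnormZ_le r q a v : 0 <= r ->
  (pnorm N rho 1 r q (a *: v)%R <= (Normc.normc a)%:E * pnorm N rho 1 r q v)%E.
Proof.
move=> r0; have na := normc_ge0 a.
rewrite !pnormE -nneseriesZl => [|n _]; last exact: pnorm_term_ge0.
apply: lee_nneseries => n _; first by move=> _; exact: pnorm_term_ge0.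
rewrite muleCA lee_wpmul2l ?lee_fin ?exprn_ge0//.
apply: wsup_le => l <- lb; rewrite uactZr csnZ EFinM.
by rewrite lee_wpmul2l ?lee_fin// wsup_ge.
Qed.

Lemma wsup_ract_le q n x v :
  (wsup q n (rho x v) <= (N x + 1)%:E * wsup q n.+1 v)%E.
Proof.
have d0 : 0 < N x + 1 by rewrite ltr_wpDl ?lie_norm_ge0.
apply: wsup_le => l ln lb.
pose y : g := (N x + 1)^-1 *: x.
have yb : N y < 1.
  by rewrite lie_normZ gtr0_norm ?invr_gt0// mulrC ltr_pdivrMr// mul1r ltrDl.
have -> : uact rho (uword l) (rho x v) =
    (N x + 1)%:C *: uact rho (uword (rcons l y)) v.
  rewrite -cats1 uword_cat uactM -uactZr -(uact_ugen rho x).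
  rewrite /uword big_seq1 -uactZl -ugenZ scalerA mulfV ?scale1r//.
  by rewrite gt_eqF.
rewrite csnZ normc_real gtr0_norm// EFinM.
apply: lee_wpmul2l; first by rewrite lee_fin ltW.
by rewrite -ln -(size_rcons l y) wsup_ge// all_rcons lb andbT.
Qed.

(** Shifting the index of the series by one and enlarging [r] to [r'] below the
    radius absorbs the extra letter. *)
Lemma analytic_ract r0 x v :
  analytic N rho 1 r0 v -> analytic N rho 1 r0 (rho x v).
Proof.
move=> av q r r_ge0 rr0; pose r' := (r + r0) / 2.
have r'_gt0 : 0 < r' by rewrite /r'; lra.
have rr' : r <= r' by rewrite /r'; lra.
have := av q r' (ltW r'_gt0); have -> : r' < r0 by rewrite /r'; lra.
move=> /(_ isT) fin.
have d0 : 0 <= (N x + 1) / r'.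
  by rewrite divr_ge0 ?(ltW r'_gt0)// addr_ge0 ?lie_norm_ge0.
apply: (@le_lt_trans _ _ (((N x + 1) / r')%:E * pnorm N rho 1 r' q v)%E);
    last first.
  move: fin; have := pnorm_ge0 q v (ltW r'_gt0).
  by case: pnorm => //= a _ _; rewrite -EFinM ltry.
rewrite !pnormE -nneseriesZl => [|n _]; last exact: pnorm_term_ge0 (ltW r'_gt0).
rewrite [leRHS]nneseries_recl//; last first.
  by move=> n; rewrite mule_ge0 ?lee_fin// pnorm_term_ge0 ?(ltW r'_gt0).
rewrite -[leLHS]add0e leeD//.
  by rewrite mule_ge0 ?lee_fin// pnorm_term_ge0 ?(ltW r'_gt0).
rewrite -[leRHS](@nneseries_addn R _ 1); last first.
  by move=> n; rewrite mule_ge0 ?lee_fin// pnorm_term_ge0 ?(ltW r'_gt0).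
apply: lee_nneseries => n _; first by move=> _; exact: pnorm_term_ge0.
apply: (@le_trans _ _ ((r' ^+ n)%:E * ((N x + 1)%:E * wsup q n.+1 v))%E).
  apply: lee_pmul; rewrite ?wsup_ge0 ?lee_fin ?exprn_ge0//.
    by rewrite lerXn2r ?nnegrE ?(le_trans r_ge0).
  exact: wsup_ract_le.
rewrite addn1 !muleA -!EFinM exprS.
rewrite [X in (X%:E * _)%E](_ : _ = (N x + 1) / r' * (r' * r' ^+ n))//.
by rewrite mulrA divfK ?gt_eqF// mulrC.
Qed.

Lemma analyticD r0 v w : analytic N rho 1 r0 v -> analytic N rho 1 r0 w ->
  analytic N rho 1 r0 (v + w).
Proof.
move=> av aw q r r_ge0 rr0; apply: (le_lt_trans (pnormD _ _ _ r_ge0)).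
by apply: lte_add_pinfty; [exact: av | exact: aw].
Qed.

Lemma analyticZ r0 a v : analytic N rho 1 r0 v -> analytic N rho 1 r0 (a *: v).
Proof.
move=> av q r r_ge0 rr0; apply: (le_lt_trans (pnormZ_le _ _ _ r_ge0)).
have := av q r r_ge0 rr0; have := pnorm_ge0 q v r_ge0.
by case: pnorm => //= b _ _; rewrite -EFinM ltry.
Qed.

Lemma analytic_uact r0 X v :
  analytic N rho 1 r0 v -> analytic N rho 1 r0 (uact rho X v).
Proof.
rewrite -[X]uclassK uact_uclass.
elim: (repr X) v => {X} [a|x|t IHt u IHu|t IHt u IHu] v av /=.
- exact: analyticZ.
- exact: analytic_ract.
- by apply: analyticD; [exact: IHt | exact: IHu].
- exact/IHt/IHu.
Qed.

(** The suprema run over the open ball, while [H] and [E] lie on its boundary;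
    the factor [a < 1] shrinks the letters into the ball. *)
Lemma word_le_pnorm q r a l v : 0 <= r -> 0 <= a -> a < 1 ->
  all (fun x => N x <= 1) l ->
  (((a * r) ^+ size l * q (uact rho (uword l) v))%:E <= pnorm N rho 1 r q v)%E.
Proof.
move=> r0 a0 a1 lb; apply: le_trans (pnorm_term_le q v (size l) r0).
rewrite exprMn mulrAC [X in X%:E]mulrC EFinM.
rewrite lee_wpmul2l ?lee_fin ?exprn_ge0//.
have -> : a ^+ size l * q (uact rho (uword l) v) =
   q (uact rho (uword [seq a *: x | x <- l]) v).
  rewrite uword_scale uactZl csnZ; congr (_ * _).
  by rewrite normcX normc_real ger0_norm.
rewrite -[X in wsup _ X](size_map (fun x => a *: x)) wsup_ge// all_map.
apply: sub_all lb => x /= x1; rewrite lie_normZ ger0_norm//.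
by rewrite (le_lt_trans _ a1)// -[leRHS]mulr1 ler_wpM2l.
Qed.

End Pnorm.

(** * High powers of E vanish on analytic vectors *)

Section Vanishing.
Context {R : realType} {s : lieAlgebra R} (N : lieNorm s) {H E : s}.
Hypotheses (brHE : lie_br H E = E) (normH : N H = 1) (normE : N E = 1).
Context {V : tvsType R[i]} (rho : representation s V).
Implicit Types (q : cseminorm V) (v : V).

Lemma ugen_comm_exp a :
  ugen H * ugen E ^+ a - ugen E ^+ a * ugen H = (a%:R : R[i]) *: ugen E ^+ a.
Proof.
rewrite scaler_nat; elim: a => [|a IH].
  by rewrite expr0 mulr1 mul1r subrr mulr0n.
have HE : ugen H * ugen E = ugen E + ugen E * ugen H.
  by rewrite -{2}brHE ugen_br subrK.
have {}IH : ugen H * ugen E ^+ a = ugen E ^+ a *+ a + ugen E ^+ a * ugen H.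
  by rewrite -IH subrK.
rewrite exprSr mulrA IH mulrDl -!mulrA HE mulrDr mulrA addrA addrK.
by rewrite mulrnAl -mulrSr.
Qed.

(** The commutator with [H] multiplies [E ^+ a] by [a], whereas [m] iterated
    commutators grow at most like [(2 / d) ^+ m] for some [d] with
    [a * d > 2]. *)
Lemma analytic_exp_eq0 q r0 a v : analytic N rho 1 r0 v -> 2 < a%:R * r0 ->
  q (uact rho (ugen E ^+ a) v) = 0.
Proof.
move=> av ar0.
have a0 : 0 < a%:R :> R.
  by rewrite ltr0n lt0n; apply: contraTneq ar0 => ->; rewrite mul0r -leNgt.
(* Both the radius and the shrinking of the letters must leave room above 2:
   [r < r0] is used to have a convergent series, [c < 1] to enter the ball. *)
pose r := (r0 + 2 / a%:R) / 2.
have arE : a%:R * r = (a%:R * r0 + 2) / 2 by rewrite /r; field; rewrite gt_eqF.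
have ar2 : 2 < a%:R * r by rewrite arE; lra.
have rr0 : r < r0 by rewrite -(ltr_pM2l a0) arE; lra.
have r_gt0 : 0 < r by rewrite -(ltr_pM2l a0) mulr0; lra.
pose c := (a%:R * r + 2) / (2 * (a%:R * r)).
have c0 : 0 <= c by rewrite divr_ge0; lra.
have c1 : c < 1 by rewrite ltr_pdivrMr; lra.
have acr : a%:R * (c * r) = (a%:R * r + 2) / 2.
  by rewrite /c; field; rewrite !gt_eqF.
have acr2 : 2 < a%:R * (c * r) by rewrite acr; lra.
have wle l := @word_le_pnorm _ _ N _ rho q r c l v (ltW r_gt0) c0 c1.
move: (c * r) acr2 wle => d ad2 wle.
have d0 : 0 < d by rewrite -(ltr_pM2l a0) mulr0; lra.
have [P wleP] : exists P : R, forall l, all (fun x => N x <= 1) l ->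
    d ^+ size l * q (uact rho (uword l) v) <= P.
  have := av q r (ltW r_gt0) rr0; have := pnorm_ge0 N rho q v (ltW r_gt0).
  case: pnorm wle => //= P wle _ _; exists P => l /wle.
  by rewrite lee_fin.
(* One more commutator turns a word with [i] letters [H] before and [j] after
   [E ^+ a] into the two words with [i + 1] before, or [j + 1] after. *)
have key m i j : (a%:R * d) ^+ m * (d ^+ (i + (a + j)) *
    q (uact rho (ugen H ^+ i * (ugen E ^+ a * ugen H ^+ j)) v)) <= 2 ^+ m * P.
  elim: m i j => [|m IH] i j.
    rewrite !expr0 !mul1r -!uword_nseq -!uword_cat.
    have := wleP (nseq i H ++ nseq a E ++ nseq j H).
    rewrite !size_cat !size_nseq; apply.
    by rewrite !all_cat !all_nseq normH normE lexx !orbT.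
  have -> : (a%:R * d) ^+ m.+1 * (d ^+ (i + (a + j)) *
      q (uact rho (ugen H ^+ i * (ugen E ^+ a * ugen H ^+ j)) v)) =
      (a%:R * d) ^+ m * (d ^+ (i + (a + j)).+1 * q
      (uact rho (ugen H ^+ i.+1 * (ugen E ^+ a * ugen H ^+ j)) v
       - uact rho (ugen H ^+ i * (ugen E ^+ a * ugen H ^+ j.+1)) v)).
    have wE : ugen H ^+ i.+1 * (ugen E ^+ a * ugen H ^+ j)
        - ugen H ^+ i * (ugen E ^+ a * ugen H ^+ j.+1) =
        (a%:R : R[i]) *: (ugen H ^+ i * (ugen E ^+ a * ugen H ^+ j)).
      rewrite [ugen H ^+ i.+1]exprSr [ugen H ^+ j.+1]exprS -mulrA -mulrBr.
      rewrite (mulrA (ugen H)) (mulrA (_ ^+ a) (ugen H)) -mulrBl ugen_comm_exp.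
      by rewrite -scalerAl -scalerAr.
    rewrite -uactBl wE uactZl csnZ normc_nat.
    by rewrite [(a%:R * d) ^+ m.+1]exprSr [d ^+ _.+1]exprSr; ring.
  rewrite [2 ^+ _]exprS -mulrA [X in _ <= X]mulr_natl mulr2n.
  have h1 := IH i.+1 j; have h2 := IH i j.+1.
  rewrite addSn in h1; rewrite !addnS in h2.
  apply: le_trans (lerD h1 h2); rewrite -!mulrDr.
  have ad_ge0 : 0 <= a%:R * d by lra.
  by rewrite !ler_wpM2l ?exprn_ge0 ?csnB// ltW.
set x := q _; have xle m : d ^+ a * x <= P * (2 / (a%:R * d)) ^+ m.
  have := key m 0 0; rewrite !expr0 mulr1 mul1r add0n addn0 -/x => kle.
  rewrite expr_div_n mulrA ler_pdivlMr ?exprn_gt0 ?mulr_gt0//.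
  by rewrite mulrC [P * _]mulrC.
have z1 : `|2 / (a%:R * d)| < 1.
  rewrite ger0_norm ?divr_ge0 ?mulr_ge0 ?(ltW d0)//.
  by rewrite ltr_pdivrMr ?mul1r ?mulr_gt0.
have : d ^+ a * x <= 0.
  rewrite -(cvg_lim _ (cvg_geometric P z1))//; apply: limr_ge.
    exact: cvgP (cvg_geometric P z1).
  by apply: nearW => m; exact: xle.
rewrite pmulr_rle0 ?exprn_gt0// => x_le0.
by apply/eqP; rewrite eq_le x_le0 csn_ge0.
Qed.

End Vanishing.

(** * Coordinates in the basis H, E *)

Section Coordinates.
Context {R : realType} {s : lieAlgebra R} (N : lieNorm s) {H E : s}.
Hypothesis basisHE : basis_of fullv [:: H; E].
Hypothesis normE : N E = 1.

Lemma basis_coord (x : s) : exists h e, x = h *: H + e *: E.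
Proof.
have := coord_basis (X := [tuple H; E]) basisHE (memvf x).
by rewrite big_ord_recl big_ord1 /= => ->; eexists; eexists.
Qed.

Lemma basis_line_neq0 e : H + e *: E != 0.
Proof.
apply/eqP => he0.
have /freeP := basis_free (X := [tuple H; E]) basisHE.
move=> /(_ (fun i => if i == 0 then 1 else e)).
rewrite big_ord_recl big_ord1 /= scale1r => /(_ he0 0) /eqP.
by rewrite oner_eq0.
Qed.

Lemma lie_norm_gt0 x : x != 0 -> 0 < N x.
Proof.
move=> x0; rewrite lt_neqAle (lie_norm_ge0 N x) andbT eq_sym.
by apply: contra x0 => /eqP /lie_norm0_eq0 ->.
Qed.

(** A continuous function without zero attains a positive minimum on a compact
    interval, and outside of it [e *: E] outweighs [H]. *)
Lemma lie_norm_line_bound : exists2 d, 0 < d & forall e, d <= N (H + e *: E).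
Proof.
pose f e := N (H + e *: E).
have flip x y : f x <= f y + `|x - y|.
  rewrite /f -[`|x - y|]mulr1 -normE -lie_normZ.
  rewrite (le_trans _ (lie_normD N _ _))// -addrA -scalerDl.
  by rewrite [y + _]addrC subrK.
have fc : continuous f.
  move=> x; apply/cvgrPdist_lt => e e0; near=> y.
  apply: (@le_lt_trans _ _ `|x - y|).
    by rewrite ler_distl flip andbT lerBlDr distrC flip.
  by near: y; apply: cvgr_dist_lt.
pose b := 1 + N H.
have b0 : 0 <= b by rewrite addr_ge0 ?lie_norm_ge0.
have [//||e0 _ min] := @EVT_min R f (- b) b.
- by lra.
- by apply: continuous_subspaceT => x; exact: fc.
exists (Num.min 1 (f e0)).
  by rewrite lt_min ltr01 lie_norm_gt0 ?basis_line_neq0.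
move=> e; rewrite ge_min; have [eb|eb] := leP `|e| b.
  by rewrite min ?orbT// in_itv /= -ler_norml.
have -> // : 1 <= N (H + e *: E).
have := lie_normD N (H + e *: E) (- H).
rewrite addrAC subrr add0r -scaleN1r !lie_normZ normE normrN1 mul1r mulr1.
by move: eb; rewrite /b; lra.
Unshelve. all: end_near. Qed.

Lemma ball_coord_bounded : exists2 c, 0 < c &
  forall x, N x < 1 -> exists h e, x = h *: H + e *: E /\ `|h| + `|e| <= c.
Proof.
have [d d0 dle] := lie_norm_line_bound.
exists (d^-1 + (1 + N H / d)) => [|x xb].
  by rewrite addr_gt0 ?invr_gt0// ltr_wpDr// divr_ge0 ?lie_norm_ge0// ltW.
have [h [e xE]] := basis_coord x; exists h, e; split=> //.
have hd : `|h| <= d^-1.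
  rewrite -[leRHS]mul1r ler_pdivlMr// (le_trans _ (ltW xb))//.
  have [->|h0] := eqVneq h 0; first by rewrite normr0 mul0r lie_norm_ge0.
  have -> : x = h *: (H + (e / h) *: E).
    by rewrite scalerDr scalerA mulrC divfK.
  by rewrite lie_normZ ler_wpM2l.
rewrite lerD//.
have := lie_normD N x (- (h *: H)).
rewrite {1}xE addrAC subrr add0r -scaleNr !lie_normZ normE mulr1 normrN.
move=> /le_trans; apply.
by rewrite lerD ?(ltW xb)// mulrC ler_wpM2l ?lie_norm_ge0.
Qed.

End Coordinates.

(** * Domination of the action of a fixed element *)

Section Domination.
Context {R : realType} {s : lieAlgebra R} (N : lieNorm s) {H E : s}.
Hypothesis basisHE : basis_of fullv [:: H; E].
Hypotheses (brHE : lie_br H E = E) (normE : N E = 1).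
Context {V : tvsType R[i]} (rho : representation s V).
Implicit Types (q : cseminorm V) (v : V).

Lemma lie_br_coord h e h' e' :
  lie_br (h *: H + e *: E) (h' *: H + e' *: E) = (h * e' - e * h') *: E.
Proof.
have brD x y y' : lie_br x (y + y') = lie_br x y + lie_br x y'.
  by have := lie_linearr x 1 y y'; rewrite !scale1r.
have brDl x x' y : lie_br (x + x') y = lie_br x y + lie_br x' y.
  by have := lie_linearl y 1 x x'; rewrite !scale1r.
have br0 x : lie_br x 0 = 0 by apply: (addrI (lie_br x 0)); rewrite -brD !addr0.
have br0l x : lie_br 0 x = 0 by apply: (addrI (lie_br 0 x)); rewrite -brDl !addr0.
have brZ a x y : lie_br x (a *: y) = a *: lie_br x y.
  by have := lie_linearr x a y 0; rewrite br0 !addr0.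
have brZl a x y : lie_br (a *: x) y = a *: lie_br x y.
  by have := lie_linearl y a x 0; rewrite br0l !addr0.
have brEH : lie_br E H = - E.
  have := lie_alt (H + E); rewrite brD !brDl !lie_alt add0r addr0 brHE => /eqP.
  by rewrite addr_eq0 => /eqP.
rewrite !brD !brDl !brZ !brZl !lie_alt brHE brEH !scaler0 addr0 add0r.
by rewrite !scalerN !scalerA scalerBl addrC mulrC (mulrC h').
Qed.

(** Bound for words with a generator inserted after [m] letters and before [j]
    letters, when words without the insertion are bounded by [M]: exchanging the
    generator with the letter on its left yields a word with [m - 1] letters
    before and [j + 1] after, and a commutator term that has lost this letter. *)
Fixpoint comm_bound (c : R) (M : nat -> \bar R) (m j : nat) : \bar R :=
  if m is m'.+1 then (comm_bound c M m' j.+1 + c%:E * comm_bound c M m' j)%E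
  else M j.

Lemma comm_bound_ge0 c M m j : 0 <= c -> (forall n, (0 <= M n)%E) ->
  (0 <= comm_bound c M m j)%E.
Proof.
by move=> c0 M0; elim: m j => //= m IH j; rewrite adde_ge0 ?mule_ge0 ?lee_fin.
Qed.

(** One seminorm that controls [u |-> q (x u)] for all [x] at once, the factor
    being the sum of the moduli of the coordinates of [x]. *)
Definition gen_csn q := add_csn (comp_csn rho q H) (comp_csn rho q E).

(** Induction from the right end of [l]: the letter next to the inserted element
    is exchanged with it first and joins [l'], or is lost in the commutator, whose
    coordinates are at most [c] times as large. *)
Lemma word_insert_le q c v l h e l' : 0 <= c ->
  (forall x, N x < 1 -> exists h e, x = h *: H + e *: E /\ `|h| + `|e| <= c) ->
  all (fun x => N x < 1) l -> all (fun x => N x < 1) l' ->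
  ((q (uact rho (uword l * (ugen (h *: H + e *: E) * uword l')) v))%:E <=
   (`|h| + `|e|)%:E *
     comm_bound c (fun n => wsup N rho (gen_csn q) n v) (size l) (size l'))%E.
Proof.
move=> c0 cb.
have cb0 m j : (0 <= comm_bound c (fun n => wsup N rho (gen_csn q) n v) m j)%E.
  by apply: comm_bound_ge0 => // n; exact: wsup_ge0.
elim/last_ind: l h e l' => [|l x IH] h e l'.
  move=> _ lb; rewrite /= /uword big_nil mul1r -/(uword l').
  apply: (@le_trans _ _ (((`|h| + `|e|) * gen_csn q (uact rho (uword l') v))%:E)).
    rewrite lee_fin ugenD !ugenZ uactM uactDl !uactZl !uact_ugen.
    rewrite (le_trans (csnD _ _ _))// !csnZ !normc_real /= mulrDr !mulrDl.
    set a := q (rho H _); set b := q (rho E _).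
    have ea : 0 <= `|e| * a by rewrite mulr_ge0 ?csn_ge0.
    have hb : 0 <= `|h| * b by rewrite mulr_ge0 ?csn_ge0.
    lra.
  rewrite EFinM lee_wpmul2l ?lee_fin ?addr_ge0//.
  exact: (wsup_ge rho (gen_csn q) v lb).
rewrite all_rcons => /andP[xb lb] lb'; rewrite size_rcons /=.
have [hx [ex [xE xc]]] := cb _ xb.
have -> : uword (rcons l x) * (ugen (h *: H + e *: E) * uword l') =
    uword l * (ugen (h *: H + e *: E) * uword (x :: l')) +
    uword l * (ugen (0 *: H + (hx * e - ex * h) *: E) * uword l').
  rewrite scale0r add0r -lie_br_coord -xE ugen_br uword_cons -cats1 uword_cat.
  rewrite {2}/uword big_seq1 -mulrA -mulrDr mulrBl -!mulrA.
  by rewrite [X in _ = _ * X]addrC subrK.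
set Y1 := (X in uact rho (X + _)); set Y2 := (X in uact rho (_ + X)).
apply: (@le_trans _ _ ((q (uact rho Y1 v))%:E + (q (uact rho Y2 v))%:E)%E).
  by rewrite -EFinD lee_fin uactDl csnD.
rewrite ge0_muleDr ?mule_ge0 ?lee_fin//; apply: leeD.
  by apply: IH => //=; rewrite xb.
apply: (le_trans (IH _ _ _ lb lb')).
rewrite muleA -EFinM lee_wpmul2r// lee_fin normr0 add0r.
apply: (@le_trans _ _ ((`|hx| + `|ex|) * (`|h| + `|e|))); last first.
  by rewrite mulrC ler_wpM2l ?addr_ge0.
rewrite (le_trans (ler_normB _ _))// !normrM mulrDr !mulrDl.
have := mulr_ge0 (normr_ge0 hx) (normr_ge0 h).
have := mulr_ge0 (normr_ge0 ex) (normr_ge0 e).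
lra.
Qed.

(** In terms of generating functions the recursion reads
    [G_j = M_j + r G_(j+1) + c r G_j]; the factor 2 and the doubled radius
    absorb the last summand when [2 c r <= 1].  Partial sums avoid any
    convergence question. *)
Lemma comm_bound_series c r M n j : 0 <= c -> 0 <= r -> 2 * c * r <= 1 ->
  (forall n, (0 <= M n)%E) ->
  (\sum_(m < n) (r ^+ m)%:E * comm_bound c M m j <=
   2%:E * \sum_(0 <= l <oo) ((2 * r) ^+ l)%:E * M (l + j)%N)%E.
Proof.
move=> c0 r0 cr M0.
have t0 l k : (0 <= ((2 * r) ^+ l)%:E * M k)%E.
  by rewrite mule_ge0 ?lee_fin ?exprn_ge0 ?mulr_ge0.
have P0 k : (0 <= \sum_(0 <= l <oo) ((2 * r) ^+ l)%:E * M (l + k)%N)%E.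
  by apply: nneseries_ge0 => *.
elim: n j => [|n IH] j; first by rewrite big_ord0 mule_ge0.
rewrite big_ord_recl /= expr0 mul1e.
have g0 := comm_bound_ge0 _ _ c0 M0.
pose S k := (\sum_(m < n) (r ^+ m)%:E * comm_bound c M m k)%E.
pose P k := (\sum_(0 <= l <oo) ((2 * r) ^+ l)%:E * M (l + k)%N)%E.
have PS k : P k = (M k + (2 * r)%:E * P k.+1)%E.
  rewrite /P nneseries_recl// expr0 mul1e; congr (_ + _)%E.
  rewrite -(@nneseries_addn R _ 1)// -nneseriesZl//.
  congr (limn _); apply/funext => N'; apply: eq_bigr => i _.
  by rewrite muleA -EFinM -exprS addn1 addSnnS.
have -> : (\sum_(i < n) (r ^+ bump 0 i)%:E *
      (comm_bound c M i j.+1 + c%:E * comm_bound c M i j))%E =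
      (r%:E * S j.+1 + (r * c)%:E * S j)%E.
  rewrite /S !ge0_sume_distrr;
    try by move=> *; rewrite mule_ge0 ?lee_fin ?exprn_ge0.
  rewrite -big_split; apply: eq_bigr => i _.
  rewrite /bump /= add1n exprS ge0_muleDr ?mule_ge0 ?lee_fin//.
  by rewrite !muleA -!EFinM; congr (_ + _%:E * _)%E; ring.
apply: (@le_trans _ _
    (M j + (r%:E * (2%:E * P j.+1) + (r * c)%:E * (2%:E * P j))))%E.
  by rewrite leeD2l// leeD// lee_wpmul2l ?IH ?lee_fin// mulr_ge0.
rewrite [leRHS](_ : _ = P j + P j)%E; last by rewrite -/(P j) -mule2n mule_natl.
rewrite [X in (_ <= X + _)%E]PS addeA muleA -EFinM [r * 2]mulrC leeD//.
by rewrite muleA -EFinM -[leRHS]mul1e lee_wpmul2r ?P0// lee_fin; lra.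
Qed.

(** The condition [t * r <= 1], instead of a lower bound on [r], makes the
    estimate hold uniformly down to [r = 0]. *)
Definition dominates X q q' t C := forall r v, 0 <= r -> t * r <= 1 ->
  (pnorm N rho 1 r q (uact rho X v) <= C%:E * pnorm N rho 1 (t * r) q' v)%E.

Lemma dominates_weaken X q q' q'' t t' C C' : 0 <= t -> 0 <= C ->
  t <= t' -> C <= C' -> (forall u, q' u <= q'' u) ->
  dominates X q q' t C -> dominates X q q'' t' C'.
Proof.
move=> t0 C0 tt' CC' qq' dX r v r0 tr.
have tr' : t * r <= t' * r by rewrite ler_wpM2r.
apply: (le_trans (dX r v r0 (le_trans tr' tr))).
apply: lee_pmul; rewrite ?lee_fin ?pnorm_ge0 ?mulr_ge0//.
by apply: le_pnorm; rewrite ?mulr_ge0.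
Qed.

Lemma ugen_dominated q x : exists t C : R,
  [/\ 0 < t, 0 < C & dominates (ugen x) q (gen_csn q) t C].
Proof.
have [c c0 cb] := ball_coord_bounded basisHE normE.
have [h [e xE]] := basis_coord basisHE x.
exists (2 * c + 2), ((`|h| + `|e| + 1) * 2); split.
- by rewrite addr_gt0 ?mulr_gt0.
- by rewrite mulr_gt0// ltr_wpDl ?addr_ge0.
move=> r v r0 tr; rewrite uact_ugen.
have cr : 2 * c * r <= 1.
  by apply: le_trans tr; rewrite ler_wpM2r// lerDl.
have r2 : 2 * r <= (2 * c + 2) * r.
  by rewrite ler_wpM2r// lerDr mulr_ge0 ?(ltW c0).
rewrite pnormE; apply: lime_le.
  by apply: is_cvg_nneseries => *; exact: pnorm_term_ge0.
apply: nearW => n; rewrite big_mkord.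
have M0 k : (0 <= wsup N rho (gen_csn q) k v)%E by exact: wsup_ge0.
have g0 := comm_bound_ge0 _ 0 (ltW c0) M0.
apply: (@le_trans _ _ ((`|h| + `|e| + 1)%:E * (\sum_(m < n) (r ^+ m)%:E *
    comm_bound c (fun n => wsup N rho (gen_csn q) n v) m 0)))%E.
  rewrite ge0_sume_distrr => [|i _]; last first.
    by rewrite mule_ge0 ?lee_fin ?exprn_ge0.
  apply: lee_sum => i _; rewrite muleCA lee_wpmul2l ?lee_fin ?exprn_ge0//.
  apply: wsup_le => l li lb.
  have := word_insert_le q v h e (ltW c0) cb lb (isT : all _ [::]).
  rewrite /uword big_nil mulr1 -xE -/(uword l) uactM uact_ugen li => /le_trans.
  by apply; rewrite lee_wpmul2r// lee_fin lerDl.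
rewrite EFinM -muleA lee_wpmul2l ?lee_fin ?addr_ge0//.
apply: le_trans (comm_bound_series _ _ (ltW c0) r0 cr M0) _.
under eq_eseriesr do rewrite addn0.
by rewrite -pnormE lee_wpmul2l// le_pnorm// mulr_ge0.
Qed.

Lemma uenv_dominated X q : exists (q' : cseminorm V) (t C : R),
  [/\ 0 < t, 0 < C & dominates X q q' t C].
Proof.
rewrite -[X]uclassK.
elim: (repr X) q => {X} [a|x|t IHt u IHu|t IHt u IHu] q.
- exists q, 1, (Normc.normc a + 1); split=> // [|r v r0 _].
    by rewrite ltr_wpDl ?normc_ge0.
  rewrite uact_uclass mul1r /= (le_trans (pnormZ_le _ _ _ _ _ r0))//.
  by rewrite lee_wpmul2r ?pnorm_ge0// lee_fin lerDl.
- by have [t [C h]] := ugen_dominated q x; exists (gen_csn q), t, C.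
- have [q1 [t1 [C1 [t10 C10 h1]]]] := IHt q.
  have [q2 [t2 [C2 [t20 C20 h2]]]] := IHu q.
  exists (add_csn q1 q2), (t1 + t2), (C1 + C2); split; rewrite ?addr_gt0//.
  have {}h1 : dominates (uclass t) q (add_csn q1 q2) (t1 + t2) C1.
    apply: dominates_weaken h1; rewrite ?lerDl ?(ltW t10) ?(ltW t20) ?(ltW C10)//.
    by move=> z /=; rewrite lerDl csn_ge0.
  have {}h2 : dominates (uclass u) q (add_csn q1 q2) (t1 + t2) C2.
    apply: dominates_weaken h2; rewrite ?lerDr ?(ltW t10) ?(ltW t20) ?(ltW C20)//.
    by move=> z /=; rewrite lerDr csn_ge0.
  move=> r v r0 tr; rewrite -uclassD uactDl (le_trans (pnormD _ _ _ _ _ r0))//.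
  rewrite EFinD ge0_muleDl ?lee_fin ?(ltW C10) ?(ltW C20)//.
  by rewrite leeD ?h1 ?h2.
- have [q1 [t1 [C1 [t10 C10 h1]]]] := IHt q.
  have [q2 [t2 [C2 [t20 C20 h2]]]] := IHu q1.
  (* The summand [t1] keeps [t1 * r <= 1], which the outer factor requires. *)
  exists q2, (t2 * t1 + t1), (C1 * C2); split; rewrite ?addr_gt0 ?mulr_gt0//.
  move=> r v r0 tr.
  have r10 : 0 <= t1 * r by rewrite mulr_ge0 ?(ltW t10).
  have r20 : 0 <= t2 * (t1 * r) by rewrite mulr_ge0 ?(ltW t20).
  have e : (t2 * t1 + t1) * r = t2 * (t1 * r) + t1 * r by ring.
  rewrite e in tr *.
  have tr1 : t1 * r <= 1 by lra.
  have tr2 : t2 * (t1 * r) <= 1 by lra.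
  rewrite -uclassM uactM (le_trans (h1 _ _ r0 tr1))// EFinM -muleA.
  rewrite lee_wpmul2l ?lee_fin ?(ltW C10)// (le_trans (h2 _ _ r10 tr2))//.
  by rewrite lee_wpmul2l ?lee_fin ?(ltW C20)// le_pnorm// lerDl.
Qed.

Lemma uenv_seq_dominated (Xs : seq (uenv s)) q :
  exists (q' : cseminorm V) (t C : R), [/\ 0 < t, 0 < C & forall X, X \in Xs -> dominates X q q' t C].
Proof.
elim: Xs => [|X Xs [q1 [t1 [C1 [t10 C10 h1]]]]]; first by exists q, 1, 1; split.
have [q2 [t2 [C2 [t20 C20 h2]]]] := uenv_dominated X q.
exists (add_csn q1 q2), (t1 + t2), (C1 + C2); split; rewrite ?addr_gt0// => Y.
rewrite inE => /predU1P[->|/h1 hY].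
  apply: dominates_weaken h2;
    rewrite ?lerDr ?(ltW t10) ?(ltW C10) ?(ltW t20) ?(ltW C20)// => u /=.
  by rewrite lerDr csn_ge0.
apply: dominates_weaken hY;
  rewrite ?lerDl ?(ltW t10) ?(ltW C10) ?(ltW t20) ?(ltW C20)// => u /=.
by rewrite lerDl csn_ge0.
Qed.

End Domination.

(** * The action of the twist *)

Section TwistAction.
Context {R : realType} {s : lieAlgebra R} (H E : s).
Context {V W : tvsType R[i]}.
Variables (rhoV : representation s V) (rhoW : representation s W).
Implicit Types (v : V) (w : W).

Lemma tact_linearl v w : linear (fun F => tact rhoV rhoW F (tpure v w)).
Proof.
have bE X Y : tmap (uact rhoV X) (uact rhoW Y) (tpure v w) =
    tpure (uact rhoV X v) (uact rhoW Y w).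
  by apply: tmap_pure; exact: uact_linear.
apply: tlift_linear => [Y a X1 X2|X a Y1 Y2]; rewrite !bE uact_linearl.
- by rewrite tpureDl tpureZl.
- by rewrite tpureDr tpureZr.
Qed.

Definition twist_coef (hbar : R[i]) n k : R[i] :=
  hbar ^+ n / n`!%:R * ((-1) ^+ k * 'C(n, k)%:R).

Lemma tact_twist_term hbar n v w :
  tact rhoV rhoW (twist_term H E hbar n) (tpure v w) =
  \sum_(k < n.+1) tpure
    (uact rhoV (twist_coef hbar n k *: (ugen E ^+ (n - k) * rising H k)) v)
    (uact rhoW (ugen E ^+ k * rising H (n - k)) w).
Proof.
have lin := tact_linearl v w.
have tD F G : tact rhoV rhoW (F + G) (tpure v w) =
    tact rhoV rhoW F (tpure v w) + tact rhoV rhoW G (tpure v w).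
  by have := lin 1 F G; rewrite !scale1r.
have t0 : tact rhoV rhoW 0 (tpure v w) = 0.
  by apply: (addrI (tact rhoV rhoW 0 (tpure v w))); rewrite -tD !addr0.
have tZ a F : tact rhoV rhoW (a *: F) (tpure v w) =
    a *: tact rhoV rhoW F (tpure v w).
  by have := lin a F 0; rewrite t0 !addr0.
rewrite /twist_term tZ /twist.
rewrite (big_morph (fun F => tact rhoV rhoW F (tpure v w)) tD t0) scaler_sumr.
apply: eq_bigr => k _.
by rewrite tZ tact_pure scalerA -/(twist_coef hbar n k) -tpureZl -uactZl.
Qed.

(** The binomial coefficients add up to [2 ^+ n], and [1 / n`!] is at most 1. *)
Lemma twist_coef_sum hbar n :
  \sum_(k < n.+1) Normc.normc (twist_coef hbar n k) <= (2 * Normc.normc hbar) ^+ n.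
Proof.
have -> : (2 * Normc.normc hbar) ^+ n =
    \sum_(k < n.+1) Normc.normc hbar ^+ n * 'C(n, k)%:R.
  rewrite -mulr_sumr exprMn mulrC; congr (_ * _).
  rewrite (_ : 2 = 1 + 1)// exprDn; apply: eq_bigr => k _.
  by rewrite !expr1n mul1r.
apply: ler_sum => k _; rewrite /twist_coef !Normc.normcM normcX Normc.normcV !normc_nat.
rewrite normcX (_ : Normc.normc (-1) = 1) ?expr1n ?mul1r; last first.
  by rewrite normcN Normc.normc1.
rewrite ler_wpM2r// ler_piMr ?exprn_ge0 ?normc_ge0//.
by rewrite invf_le1 ?ler1n ?ltr0n fact_gt0.
Qed.

Lemma projective_sum_le n (A : set V) (B : set W)
    (p : V -> \bar R) (q : W -> \bar R) (x : 'I_n -> V) (y : 'I_n -> W) :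
  (forall k, A (x k)) -> (forall k, B (y k)) ->
  (projective A B p q (\sum_(k < n) tpure (x k) (y k))%R <=
   \sum_(k < n) p (x k) * q (y k))%E.
Proof.
move=> Ax By; apply: ereal_inf_lbound.
exists [seq (x k, y k) | k <- index_enum 'I_n]; last by rewrite big_map.
split; last by rewrite big_map.
by move=> _ /mapP[k _ ->] /=.
Qed.

Lemma twist_term_le (N : lieNorm s) (A : set V) (B : set W) (r : R)
    (qV : cseminorm V) (qW : cseminorm W) hbar n v w : 0 <= r ->
  (forall X, A (uact rhoV X v)) -> (forall X, B (uact rhoW X w)) ->
  (projective A B (pnorm N rhoV 1 r qV) (pnorm N rhoW 1 r qW)
     (tact rhoV rhoW (twist_term H E hbar n) (tpure v w)) <=
   \sum_(k < n.+1) (Normc.normc (twist_coef hbar n k))%:E *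
     (pnorm N rhoV 1 r qV (uact rhoV (ugen E ^+ (n - k) * rising H k)%R v) *
      pnorm N rhoW 1 r qW (uact rhoW (ugen E ^+ k * rising H (n - k))%R w)))%E.
Proof.
move=> r0 Av Bw; rewrite tact_twist_term.
apply: (le_trans (projective_sum_le _ _ _ _)) => //.
apply: lee_sum => k _; rewrite muleA lee_wpmul2r ?pnorm_ge0// uactZl.
exact: pnormZ_le.
Qed.

End TwistAction.

(** * The estimates *)

Section Annihilation.
Context {R : realType} {s : lieAlgebra R} (N : lieNorm s) {H E : s}.
Hypotheses (brHE : lie_br H E = E) (normH : N H = 1) (normE : N E = 1).
Context {V : tvsType R[i]} (rho : representation s V).

(** A word followed by a seminorm is again a continuous seminorm, so that all
    coefficients of the series vanish, not only the first. *)
Lemma pnorm_exp_eq0 r (q : cseminorm V) r0 a X v : 0 <= r ->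
  analytic N rho 1 r0 v -> 2 < a%:R * r0 ->
  pnorm N rho 1 r q (uact rho (ugen E ^+ a * X) v) = 0%E.
Proof.
move=> r_ge0 av ar; rewrite uactM.
have {av} : analytic N rho 1 r0 (uact rho X v) by exact: analytic_uact.
move: (uact _ X v) => {X} {}v av.
rewrite pnormE eseries0// => n _ _.
rewrite (_ : wsup _ _ _ _ _ = 0%E) ?mule0//.
apply/eqP; rewrite eq_le wsup_ge0 andbT.
apply: wsup_le => l _ _; rewrite lee_fin.
elim: l q => [|x l IH] q.
  by rewrite /uword big_nil uact1 (analytic_exp_eq0 brHE normH normE q av ar).
rewrite uword_cons uactM uact_ugen; exact: (IH (comp_csn rho q x)).
Qed.

Lemma entire_uact X v : entire N rho 1 v -> entire N rho 1 (uact rho X v).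
Proof. by move=> ev r0 r00; apply/analytic_uact/ev. Qed.

End Annihilation.

Lemma exists_nat_mul_gt {R : realType} (x r : R) : 0 <= x -> 0 < r ->
  exists n, forall m, (n <= m)%N -> x < m%:R * r.
Proof.
move=> x0 r0; exists (Num.bound (x / r)) => m nm.
rewrite -ltr_pdivrMr// (lt_le_trans (archi_boundP _)) ?ler_nat//.
by rewrite divr_ge0 ?(ltW r0).
Qed.

Theorem proposition4p3 (R : realType)
    (s : lieAlgebra R) (N : lieNorm s) (H E : s)
    (basisHE : basis_of fullv [:: H; E])
    (brHE : lie_br H E = E) (normH : N H = 1) (normE : N E = 1)
    (V W X : tvsType R[i])
    (rhoV : representation s V) (rhoW : representation s W)
    (rhoX : representation s X) (mu : {linear tens V W -> X})
    (mu_malleable : malleable rhoV rhoW rhoX mu)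
    (SV : frSystem V) (SW : frSystem W) (SX : frSystem X)
    (mu_inductive : inductive_triple rhoV rhoW rhoX mu SV SW SX)
    (rhoSV : forall a, representation s (fr_space SV a))
    (rhoSW : forall b, representation s (fr_space SW b))
    (rhoSVE : is_restriction rhoV rhoSV) (rhoSWE : is_restriction rhoW rhoSW) :
  (forall (r : R) (qV : cseminorm V) (qW : cseminorm W)
      (K : set (R[i] : numFieldType)), 0 < r -> compact K ->
    exists (qV' : cseminorm V) (qW' : cseminorm W) (t C : R),
      [/\ 0 < t, 0 < C &
       forall v w (hbar : R[i]) (n : nat),
         entire N rhoV 1 v -> entire N rhoW 1 w -> K hbar ->
         (projective (entire N rhoV 1) (entire N rhoW 1)
            (pnorm N rhoV 1 r qV) (pnorm N rhoW 1 r qW)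
            (tact rhoV rhoW (twist_term H E hbar n) (tpure v w))
          <= C%:E * pnorm N rhoV 1 (t * r) qV' v
                  * pnorm N rhoW 1 (t * r) qW' w)%E])
  /\
  (forall (a : SV) (b : SW) (r1 r2 : R)
      (qa : cseminorm (fr_space SV a)) (qb : cseminorm (fr_space SW b))
      (K : set (R[i] : numFieldType)), 0 < r1 -> 0 < r2 -> compact K ->
    exists (qa' : cseminorm (fr_space SV a)) (qb' : cseminorm (fr_space SW b))
        (t C : R),
      [/\ 0 < t, 0 < C &
       forall v w (r : R) (hbar : R[i]) (n : nat),
         analytic N (rhoSV a) 1 r1 v -> analytic N (rhoSW b) 1 r2 w ->
         0 <= r -> r < 2 `^ (- 1) / t * Num.min r1 r2 -> K hbar ->
         (projective (analytic N (rhoSV a) 1 r1) (analytic N (rhoSW b) 1 r2)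
            (pnorm N (rhoSV a) 1 r qa) (pnorm N (rhoSW b) 1 r qb)
            (tact (rhoSV a) (rhoSW b) (twist_term H E hbar n) (tpure v w))
          <= C%:E * pnorm N (rhoSV a) 1 (t * r) qa' v
                  * pnorm N (rhoSW b) 1 (t * r) qb' w)%E]).
Proof.
split.
  move=> r qV qW K r0 _; exists qV, qW, 1, 1; split=> // v w hbar n ev ew _.
  rewrite !mul1r mul1e.
  apply: le_trans.
    apply: twist_term_le; first exact: ltW.
      by move=> X'; exact: entire_uact.
    by move=> X'; exact: entire_uact.
  (* Entire vectors are analytic of radius 3, for which [E] already vanishes. *)
  have ev3 : analytic N rhoV 1 3 v := ev 3 (ltr0n R 3).
  have ew3 : analytic N rhoW 1 3 w := ew 3 (ltr0n R 3).
  have [->|n0] := posnP n.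
    rewrite big_ord1 /twist_coef !expr0 fact0 bin0 invr1 !mulr1.
    by rewrite Normc.normc1 mul1e /rising !big_ord0 mul1r !uact1.
  rewrite big1 ?mule_ge0 ?pnorm_ge0 ?(ltW r0)// => k _.
  have [kn|kn] := ltnP k n.
    rewrite (pnorm_exp_eq0 brHE normH normE _ _ (ltW r0) ev3) ?mul0e ?mule0//.
    have : (1 : R) <= (n - k)%:R by rewrite ler1n subn_gt0.
    by lra.
  rewrite (pnorm_exp_eq0 brHE normH normE _ _ (ltW r0) ew3) ?mule0//.
  have : (1 : R) <= k%:R by rewrite ler1n (leq_trans n0).
  by lra.
move=> a b r1 r2 qa qb K r10 r20 /compact_normc_bounded[B B1 KB].
have [n1 hn1] := exists_nat_mul_gt (ler0n R 2) r10.
have [n2 hn2] := exists_nat_mul_gt (ler0n R 2) r20.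
pose M := (n1 + n2)%N.
pose Xs := [seq ugen E ^+ i * rising H j | i <- iota 0 M, j <- iota 0 M].
have XsP i j : (i < M)%N -> (j < M)%N -> ugen E ^+ i * rising H j \in Xs.
  by move=> iM jM; apply/allpairsP; exists (i, j); rewrite !mem_iota.
have [qa' [ta [Ca [ta0 Ca0 da]]]] :=
  uenv_seq_dominated basisHE brHE normE (rhoSV a) Xs qa.
have [qb' [tb [Cb [tb0 Cb0 db]]]] :=
  uenv_seq_dominated basisHE brHE normE (rhoSW b) Xs qb.
pose r12 := Num.min r1 r2.
have r120 : 0 < r12 by rewrite lt_min r10.
(* The factor [1 + r12] turns [t * r < r12 / 2] into [(ta + tb) * r <= 1]. *)
pose t := (ta + tb) * (1 + r12).
have t0 : 0 < t by rewrite mulr_gt0 ?addr_gt0.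
exists qa', qb', t, ((2 * B) ^+ M * (Ca * Cb)).
have C0 : 0 < (2 * B) ^+ M * (Ca * Cb).
  by rewrite !mulr_gt0// exprn_gt0// mulr_gt0// (lt_le_trans ltr01).
split=> // v w r hbar n av aw r_ge0 rt Kh.
apply: le_trans.
  apply: twist_term_le => //; first by move=> X'; exact: analytic_uact.
  by move=> X'; exact: analytic_uact.
have tr0 : 0 <= t * r by rewrite mulr_ge0 ?(ltW t0).
(* For [n >= n1 + n2] one of the exponents [n - k] and [k] of [E] is large. *)
have [nM|nM] := leqP M n.
  rewrite big1 => [|k _].
    by rewrite !mule_ge0 ?pnorm_ge0// lee_fin ltW.
  have [kn|kn] := leqP n1 (n - k).
    by rewrite (pnorm_exp_eq0 brHE normH normE _ _ r_ge0 av) ?mul0e ?mule0// hn1.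
  rewrite (pnorm_exp_eq0 brHE normH normE _ _ r_ge0 aw) ?mule0// hn2//.
  by rewrite -(leq_add2l n1) (leq_trans nM)// addnC -leq_subLR ltnW.
have tab : (ta + tb) * r <= 1.
  rewrite -(@ler_pM2r _ (1 + r12)); last by rewrite ltr_wpDl.
  rewrite mul1r mulrAC -/t (@le_trans _ _ r12)//; last by rewrite lerDr.
  rewrite mulrC -ler_pdivlMr// (le_trans (ltW rt))//.
  rewrite powR_inv1// -mulrA [t^-1 * _]mulrC ler_piMl ?divr_ge0 ?(ltW t0) ?(ltW r120)//.
  by rewrite invf_le1 ?ler1n.
have tle : (ta + tb) * r <= t * r.
  by rewrite ler_wpM2r// ler_peMr ?lerDl ?(ltW r120)// ltW ?addr_gt0.
have tar : ta * r <= (ta + tb) * r by rewrite ler_wpM2r// lerDl ltW.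
have tbr : tb * r <= (ta + tb) * r by rewrite ler_wpM2r// lerDr ltW.
have pa0 := pnorm_ge0 N (rhoSV a) qa' v tr0.
have pb0 := pnorm_ge0 N (rhoSW b) qb' w tr0.
apply: (@le_trans _ _ (\sum_(k < n.+1) (Normc.normc (twist_coef hbar n k))%:E *
    ((Ca%:E * pnorm N (rhoSV a) 1 (t * r) qa' v) *
     (Cb%:E * pnorm N (rhoSW b) 1 (t * r) qb' w)))%E).
  apply: lee_sum => k _.
  have kM : (k < M)%N := leq_ltn_trans (ltn_ord k : (k <= n)%N) nM.
  have nkM : (n - k < M)%N := leq_ltn_trans (leq_subr k n) nM.
  rewrite lee_wpmul2l ?lee_fin ?normc_ge0//.
  apply: lee_pmul; rewrite ?pnorm_ge0//.
    apply: le_trans (da _ _ r v r_ge0 (le_trans tar tab)) _.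
      exact: XsP.
    rewrite lee_wpmul2l ?lee_fin ?(ltW Ca0)// le_pnorm ?(le_trans tar)//.
    by rewrite mulr_ge0 ?(ltW ta0).
  apply: le_trans (db _ _ r w r_ge0 (le_trans tbr tab)) _.
    exact: XsP.
  rewrite lee_wpmul2l ?lee_fin ?(ltW Cb0)// le_pnorm ?(le_trans tbr)//.
  by rewrite mulr_ge0 ?(ltW tb0).
rewrite -ge0_sume_distrl => [|k _]; last by rewrite lee_fin normc_ge0.
rewrite sumEFin [(Ca%:E * _ * _)%E]muleACA -EFinM [leLHS]muleA -EFinM.
rewrite -[leRHS]muleA lee_wpmul2r ?mule_ge0// lee_fin.
rewrite ler_wpM2r ?mulr_ge0 ?(ltW Ca0) ?(ltW Cb0)//.
apply: (le_trans (twist_coef_sum hbar n)).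
apply: (@le_trans _ _ ((2 * B) ^+ n)).
  by rewrite lerXn2r ?nnegrE ?mulr_ge0 ?normc_ge0 ?ler_wpM2l ?KB// (le_trans ler01).
by rewrite ler_weXn2l ?(ltnW nM)//; lra.
Qed.
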